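(* Let $g_t$ ($|t|<\varepsilon$) be a smooth family of adapted Riemannian metrics on $(M,\widetilde{\mathcal D},\mathcal D)$ with $\operatorname{rank}\widetilde{\mathcal D}=n$, $\operatorname{rank}\mathcal D=p$, and let $S=\partial_tg_t$. All quantities are computed with respect to $g=g_t$. (1) For $\mathcal D$-variations (i.e. $S$ is $\mathcal D$-truncated), $$\partial_t\|\tilde h\|^2=\langle\operatorname{div}\tilde h+\tilde{\mathcal K}^\flat,S\rangle-\operatorname{div}(\langle\tilde h,S\rangle),\qquad \partial_t\|\tilde H\|^2=\langle(\operatorname{div}\tilde H)g,S\rangle-\operatorname{div}((\operatorname{Tr}_gS)\tilde H),$$ $$\partial_t(\|h\|^2-\|H\|^2)=\langle\Phi_h,S\rangle,\qquad\partial_t\|\tilde T\|^2=\langle2\,\widetilde{\mathcal T}^\flat,S\rangle,\qquad\partial_t\|T\|^2=-\langle\Phi_T,S\rangle.$$ (2) For $\mathcal D$-conformal variations, i.e. $S=s\,g^\perp$ with $s$ a smooth function on $M$ (for each $t$), $$\partial_t\|\tilde h\|^2=s\operatorname{div}\tilde H-\operatorname{div}(s\tilde H),\qquad\partial_t\|\tilde H\|^2=p\,(s\operatorname{div}\tilde H-\operatorname{div}(s\tilde H)),$$ $$\partial_t\|h\|^2=-s\|h\|^2,\quad\partial_t\|H\|^2=-s\|H\|^2,\quad\partial_t\|\tilde T\|^2=-2s\|\tilde T\|^2,\quad\partial_t\|T\|^2=s\|T\|^2.$$ (3) The formulas for $\widetilde{\mathcal D}$-variations are dual: if $S$ is $\widetilde{\mathcal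 D}$-truncated, then $$\partial_t\|h\|^2=\langle\operatorname{div}h+\mathcal K^\flat,S\rangle-\operatorname{div}(\langle h,S\rangle),\qquad\partial_t\|H\|^2=\langle(\operatorname{div}H)g,S\rangle-\operatorname{div}((\operatorname{Tr}_gS)H),$$ $$\partial_t(\|\tilde h\|^2-\|\tilde H\|^2)=\langle\Phi_{\tilde h},S\rangle,\qquad\partial_t\|T\|^2=\langle2\,\mathcal T^\flat,S\rangle,\qquad\partial_t\|\tilde T\|^2=-\langle\Phi_{\tilde T},S\rangle,$$ and if $S=s\,\tilde g$, then $$\partial_t\|h\|^2=s\operatorname{div}H-\operatorname{div}(sH),\qquad\partial_t\|H\|^2=n\,(s\operatorname{div}H-\operatorname{div}(sH)),$$ $$\partial_t\|\tilde h\|^2=-s\|\tilde h\|^2,\quad\partial_t\|\tilde H\|^2=-s\|\tilde H\|^2,\quad\partial_t\|T\|^2=-2s\|T\|^2,\quad\partial_t\|\tilde T\|^2=s\|\tilde T\|^2.$$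
   Context: Everything is smooth; $M$ is a connected manifold; $TM=\widetilde{\mathcal D}\oplus\mathcal D$; $X^\top,X^\perp$ are the components of $X$ in $\widetilde{\mathcal D}$ and $\mathcal D$. A Riemannian metric $g$ is adapted if $g(X^\top,Y^\perp)=0$ for all $X,Y$; $g^\perp(X,Y)=g(X^\perp,Y^\perp)$, $\tilde g(X,Y)=g(X^\top,Y^\top)$. A symmetric $(0,2)$-tensor $S$ is $\mathcal D$-truncated if $S(X^\top,\cdot)=0$, $\widetilde{\mathcal D}$-truncated if $S(X^\perp,\cdot)=0$. $\nabla$ is the Levi-Civita connection. $\{E_a\}_{a\le n}$, $\{\mathcal E_i\}_{i\le p}$ are local orthonormal frames of $\widetilde{\mathcal D}$, $\mathcal D$; a subscript $a$ or $i$ on an operator means evaluation at $E_a$ or $\mathcal E_i$. For $X,Y\in\widetilde{\mathcal D}$, $T(X,Y)=\frac12[X,Y]^\perp$, $h(X,Y)=\frac12(\nabla_XY+\nabla_YX)^\perp$; for $X,Y\in\mathcal D$, $\tilde T(X,Y)=\frac12[X,Y]^\top$, $\tilde h(X,Y)=\frac12(\nabla_XY+\nabla_YX)^\top$; extended by zero to $TM$. $H=\sum_ah(E_a,E_a)$, $\tilde H=\sum_i\tilde h(\mathcal E_i,\mathcal E_i)$. For $Z\in\mathcal D$, on $\widetilde{\mathcal D}$: $g(A_ZX,Y)=g(h(X,Y),Z)$, $g(T^\sharp_ZX,Y)=g(T(X,Y),Z)$. For $Y\in\widetilde{\mathcal D}$, on $\mathcal D$: $g(\tilde A_YX,Z)=g(\tilde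 h(X,Z),Y)$, $g(\tilde T^\sharp_YX,Z)=g(\tilde T(X,Z),Y)$. $\widetilde{\mathcal T}=\sum_a(\tilde T^\sharp_a)^2$, $\mathcal T=\sum_i(T^\sharp_i)^2$, $\tilde{\mathcal K}=\sum_a(\tilde T^\sharp_a\tilde A_a-\tilde A_a\tilde T^\sharp_a)$, $\mathcal K=\sum_i(T^\sharp_iA_i-A_iT^\sharp_i)$; $B^\flat(X,Y)=g(BX,Y)$. Norms: $\|h\|^2=\sum_{a,b}\|h(E_a,E_b)\|^2$, $\|T\|^2=\sum_{a,b}\|T(E_a,E_b)\|^2$, $\|\tilde h\|^2=\sum_{i,j}\|\tilde h(\mathcal E_i,\mathcal E_j)\|^2$, $\|\tilde T\|^2=\sum_{i,j}\|\tilde T(\mathcal E_i,\mathcal E_j)\|^2$. $\langle\cdot,\cdot\rangle$ on $(0,2)$-tensors is the $g$-inner product; $\langle\tilde h,S\rangle=\sum_{i,j}S(\mathcal E_i,\mathcal E_j)\,\tilde h(\mathcal E_i,\mathcal E_j)$ and $\langle h,S\rangle=\sum_{a,b}S(E_a,E_b)\,h(E_a,E_b)$ are vector fields. $\Phi_h,\Phi_T$ are the $\mathcal D$-truncated symmetric tensors with $\langle\Phi_h,S\rangle=S(H,H)-\sum_{a,b}S(h(E_a,E_b),h(E_a,E_b))$, $\langle\Phi_T,S\rangle=-\sum_{a,b}S(T(E_a,E_b),T(E_a,E_b))$ for all $\mathcal D$-truncated symmetric $S$; the $\widetilde{\mathcal D}$-truncated $\Phi_{\tilde h},\Phi_{\tilde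 T}$ are defined dually from $\tilde h,\tilde H,\tilde T,\mathcal E_i$. $\operatorname{div}\xi=\operatorname{Tr}(\nabla\xi)$ for vector fields; for a $(1,2)$-tensor $P$, $(\operatorname{div}P)(X,Y)=\sum_ag((\nabla_{E_a}P)(X,Y),E_a)+\sum_ig((\nabla_{\mathcal E_i}P)(X,Y),\mathcal E_i)$. A $\mathcal D$-variation has the form $g_t=g_t^\perp+\tilde g$ with $\tilde g$ independent of $t$; a $\widetilde{\mathcal D}$-variation has the form $g_t=g^\perp+\tilde g_t$ with $g^\perp$ independent of $t$. *)

(* Defs.v *)
From HB Require Import structures.
From mathcomp Require Import all_boot all_order all_algebra.
From mathcomp Require Import all_classical all_reals all_analysis.

Set Implicit Arguments.
Unset Strict Implicit.
Unset Printing Implicit Defensive.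

Import Order.TTheory GRing.Theory Num.Theory.
Import numFieldNormedType.Exports.
Local Open Scope classical_set_scope.
Local Open Scope ring_scope.

(* [Ck k U f]: f is of class C^k on the open set U; 'D_v f is the directional
   derivative along v. *)
Fixpoint Ck (R : realType) (V W : normedModType R) (k : nat) (U : set V)
    (f : V -> W) : Prop :=
  if k is k'.+1 then
    (forall x, U x -> differentiable f x) /\
    (forall v : V, Ck k' U ('D_v f : V -> W))
  else forall x, U x -> {for x, continuous f}.

Definition smooth_on (R : realType) (V W : normedModType R) (U : set V)
  (f : V -> W) : Prop := forall k, Ck k U f.

(* A smooth manifold of dimension m, possibly empty.  An atlas is given by a
   choice of one chart around each point: [chart x], with domain [dom x] and
   inverse [param x], is a chart around x. *)
Record manifold (R : realType) (m : nat) := Manifold {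
  carrier :> topologicalType;
  dom : carrier -> set carrier;
  chart : carrier -> carrier -> 'rV[R]_m;
  param : carrier -> 'rV[R]_m -> carrier;
  manifold_hausdorff : hausdorff_space carrier;
  manifold_second_countable : @second_countable carrier;
  dom_open : forall x, open (dom x);
  dom_self : forall x, dom x x;
  codom_open : forall x, open (chart x @` dom x);
  chartK : forall x y, dom x y -> param x (chart x y) = y;
  chart_continuous : forall x y, dom x y -> {for y, continuous (chart x)};
  param_continuous : forall x q, (chart x @` dom x) q ->
    {for q, continuous (param x)};
  transition_smooth : forall x y,
    smooth_on (chart x @` (dom x `&` dom y)) (chart y \o param x)
}.

(* The tangent space at x is 'rV[R]_m: a tangent vector at x is represented by
   its components in the chart [chart x]. *)
Definition vfield (R : realType) (m : nat) (M : manifold R m) : Type :=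
  M -> 'rV[R]_m.

(* (0,2)-tensors, pointwise *)
Definition tensor2 (R : realType) (m : nat) (M : manifold R m) : Type :=
  M -> 'rV[R]_m -> 'rV[R]_m -> R.

(* (0,2)- and (1,2)-tensors, as operations on vector fields *)
Definition field_form (R : realType) (m : nat) (M : manifold R m) : Type :=
  vfield M -> vfield M -> M -> R.
Definition field_op2 (R : realType) (m : nat) (M : manifold R m) : Type :=
  vfield M -> vfield M -> vfield M.

(* [nabla x v Y] is the covariant derivative of the field Y at x along the
   tangent vector v at x *)
Definition connection (R : realType) (m : nat) (M : manifold R m) : Type :=
  forall x : M, 'rV[R]_m -> vfield M -> 'rV[R]_m.

Definition plane_field (R : realType) (m : nat) (M : manifold R m) : Type :=
  M -> {vspace 'rV[R]_m}.

Section Manifold.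
Variables (R : realType) (m : nat) (M : manifold R m).
Implicit Types (X Y Z : vfield M) (D : plane_field M) (U : set M)
  (g S : tensor2 M) (nabla : connection M) (f : M -> R).

(* change of components, from the chart at x to the chart at y, of a tangent
   vector with base point z in dom x `&` dom y *)
Definition change_chart (x y z : M) : 'rV[R]_m -> 'rV[R]_m :=
  'd (chart y \o param x) (chart x z).

(* components of the field X in the chart at x, as a function on the image of
   that chart *)
Definition incoord (x : M) X : 'rV[R]_m -> 'rV[R]_m :=
  fun q => change_chart (param x q) x (param x q) (X (param x q)).

Definition smooth_fun U f : Prop :=
  forall x, smooth_on (chart x @` (dom x `&` U)) (f \o param x : _ -> R^o).

Definition smooth_vf U X : Prop :=
  forall x, smooth_on (chart x @` (dom x `&` U)) (incoord x X).

Definition smooth_fun_near (x : M) f : Prop :=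
  exists2 U, open_nbhs x U & smooth_fun U f.

Definition smooth_vf_near (x : M) X : Prop :=
  exists2 U, open_nbhs x U & smooth_vf U X.

Definition tensor_incoord (x : M) S (u v : 'rV[R]_m) : 'rV[R]_m -> R :=
  fun q => let z := param x q in
    S z (change_chart x z z u) (change_chart x z z v).

Definition smooth_family (eps : R) (g : R -> tensor2 M) : Prop :=
  forall (x : M) (u v : 'rV[R]_m),
    smooth_on [set tq : R^o * 'rV[R]_m | `|tq.1 : R| < eps /\
                                         (chart x @` dom x) tq.2]
      (fun tq : R^o * 'rV[R]_m => tensor_incoord x (g tq.1) u v tq.2 : R^o).

Definition dirder (x : M) (v : 'rV[R]_m) f : R :=
  'D_v (f \o param x : _ -> R^o) (chart x x).

Definition bracket X Y : vfield M := fun x =>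
  'D_(X x) (incoord x Y) (chart x x) - 'D_(Y x) (incoord x X) (chart x x).

Definition on_fields S : field_form M := fun X Y x => S x (X x) (Y x).

Definition symmetric_tensor U S : Prop :=
  forall x, U x ->
    (forall u v, S x u v = S x v u) /\
    (forall (a : R) u v w, S x (a *: u + v) w = a * S x u w + S x v w).

Definition riemannian g : Prop :=
  symmetric_tensor setT g /\ (forall x u, u != 0 -> 0 < g x u u).

Definition is_connection nabla : Prop :=
  [/\ forall x (a : R) u v Y, smooth_vf_near x Y ->
        nabla x (a *: u + v) Y = a *: nabla x u Y + nabla x v Y,
      forall x v Y Z, smooth_vf_near x Y -> smooth_vf_near x Z ->
        nabla x v (fun y => Y y + Z y) = nabla x v Y + nabla x v Z,
      forall x v f Y, smooth_fun_near x f -> smooth_vf_near x Y ->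
        nabla x v (fun y => f y *: Y y)
          = dirder x v f *: Y x + f x *: nabla x v Y &
      forall U X Y, open U -> smooth_vf U X -> smooth_vf U Y ->
        smooth_vf U (fun y => nabla y (X y) Y)].

Definition cov nabla X Y : vfield M := fun x => nabla x (X x) Y.

Definition levi_civita g nabla : Prop :=
  [/\ is_connection nabla,
      forall x X Y, smooth_vf_near x X -> smooth_vf_near x Y ->
        cov nabla X Y x - cov nabla Y X x = bracket X Y x &
      forall x v Y Z, smooth_vf_near x Y -> smooth_vf_near x Z ->
        dirder x v (on_fields g Y Z)
          = g x (nabla x v Y) (Z x) + g x (Y x) (nabla x v Z)].

(* div xi = Tr (v |-> nabla_v xi) *)
Definition divergence nabla X : M -> R :=
  fun x => \tr (lin1_mx (fun v => nabla x v X)).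

(* (nabla_V P)(X, Y) *)
Definition cov_op2 nabla V (P : field_op2 M) : field_op2 M := fun X Y x =>
  cov nabla V (P X Y) x - P (cov nabla V X) Y x - P X (cov nabla V Y) x.

Definition smooth_distribution (k : nat) D : Prop :=
  (forall x, \dim (D x) = k) /\
  (forall x, exists U (X : 'I_k -> vfield M),
     [/\ open_nbhs x U, forall i, smooth_vf U (X i) &
         forall y, U y -> D y = <<[seq X i y | i <- enum 'I_k]>>%VS]).

Definition direct_decomposition D1 D2 : Prop :=
  forall x, (D1 x + D2 x = fullv)%VS /\ (D1 x :&: D2 x = 0)%VS.

(* component in D1 along D2: with TM = Dt + D, the vector v^top is
   [component Dt D x v] and v^perp is [component D Dt x v] *)
Definition component D1 D2 (x : M) (v : 'rV[R]_m) : 'rV[R]_m :=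
  daddv_pi (D1 x) (D2 x) v.

Definition component_vf D1 D2 X : vfield M := fun x => component D1 D2 x (X x).

Definition adapted D1 D2 g : Prop :=
  forall x u v, g x (component D1 D2 x u) (component D2 D1 x v) = 0.

Definition restrict_metric D1 D2 g : tensor2 M :=
  fun x u v => g x (component D1 D2 x u) (component D1 D2 x v).

(* S vanishes when one argument is in D1 *)
Definition null_on D1 D2 S : Prop :=
  forall x u v, S x (component D1 D2 x u) v = 0.

Definition orthonormal_frame (k : nat) g D U (E : 'I_k -> vfield M) : Prop :=
  (forall a, smooth_vf U (E a)) /\
  (forall x, U x -> (forall a, E a x \in D x) /\
                    (forall a b, g x (E a x) (E b x) = (a == b)%:R)).

(* In what follows D1 and D2 are complementary distributions.  Taking (D1, D2)
   to be (Dt, D) gives h, T, H, A_Z, ...; taking (D, Dt) gives the same objects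
   with a tilde. *)

Definition second_form nabla D1 D2 : field_op2 M := fun X Y =>
  component_vf D2 D1 (fun x => 2^-1 *:
    (cov nabla (component_vf D1 D2 X) (component_vf D1 D2 Y) x
     + cov nabla (component_vf D1 D2 Y) (component_vf D1 D2 X) x)).

Definition integrability D1 D2 : field_op2 M := fun X Y =>
  component_vf D2 D1 (fun x =>
    2^-1 *: bracket (component_vf D1 D2 X) (component_vf D1 D2 Y) x).

(* the operator B_Z on D1 with g(B_Z X, Y) = g(B(X, Y), Z) for Y in D1; this is
   A_Z for B = h and T^sharp_Z for B = T, extended by zero to TM *)
Definition adjoint_op g D1 (B : field_op2 M) Z X : vfield M := fun x =>
  xget 0 [set w | w \in D1 x /\
    forall Y, smooth_vf_near x Y -> (\forall y \near x, Y y \in D1 y) ->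
      g x w (Y x) = g x (B X Y x) (Z x)].

Definition flat g (B : vfield M -> vfield M) : field_form M :=
  fun X Y => on_fields g (B X) Y.

Definition sqnorm g X : M -> R := on_fields g X X.

Section Frame.
Variables (k : nat) (E : 'I_k -> vfield M).

Definition trace_vf (B : field_op2 M) : vfield M :=
  fun x => \sum_(a < k) B (E a) (E a) x.

Definition sqnorm2 g (B : field_op2 M) : M -> R :=
  fun x => \sum_(a < k) \sum_(b < k) sqnorm g (B (E a) (E b)) x.

(* the vector field <B, S> *)
Definition tensor_contraction (B : field_op2 M) S : vfield M :=
  fun x => \sum_(a < k) \sum_(b < k)
    S x (E a x) (E b x) *: B (E a) (E b) x.

Definition sum_along (B : field_op2 M) S : M -> R :=
  fun x => \sum_(a < k) \sum_(b < k) S x (B (E a) (E b) x) (B (E a) (E b) x).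

Definition sum_sq (T : vfield M -> vfield M -> vfield M) X : vfield M :=
  fun x => \sum_(a < k) T (E a) (T (E a) X) x.

Definition sum_comm (T A : vfield M -> vfield M -> vfield M) X : vfield M :=
  fun x => \sum_(a < k) (T (E a) (A (E a) X) x - A (E a) (T (E a) X) x).

End Frame.

Section FullFrame.
Variables (n p : nat) (E : 'I_n -> vfield M) (F : 'I_p -> vfield M).

Definition full_frame (k : 'I_n + 'I_p) : vfield M :=
  match k with inl a => E a | inr i => F i end.

Definition inner2 (b c : field_form M) : M -> R := fun x =>
  \sum_(k : 'I_n + 'I_p) \sum_(l : 'I_n + 'I_p)
    b (full_frame k) (full_frame l) x * c (full_frame k) (full_frame l) x.

Definition trace2 S : M -> R := fun x =>
  \sum_(k : 'I_n + 'I_p) S x (full_frame k x) (full_frame k x).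

Definition div_op2 g nabla (P : field_op2 M) : field_form M := fun X Y x =>
  \sum_(k : 'I_n + 'I_p)
    g x (cov_op2 nabla (full_frame k) P X Y x) (full_frame k x).

(* Phi is, over U, the symmetric tensor null on D1 with <Phi, S> = q S for all
   symmetric tensors S null on D1 *)
Definition represents U D1 D2 (q : tensor2 M -> M -> R) (Phi : tensor2 M) :
    Prop :=
  [/\ symmetric_tensor U Phi,
      forall x, U x -> forall u v, Phi x (component D1 D2 x u) v = 0 &
      forall S, symmetric_tensor setT S -> null_on D1 D2 S ->
        forall x, U x -> inner2 (on_fields Phi) (on_fields S) x = q S x].

End FullFrame.

End Manifold.

Definition dt_metric (R : realType) (m : nat) (M : manifold R m)
    (g : R -> tensor2 M) (t : R) : tensor2 M :=
  fun x u v => derive1 (fun r : R^o => g r x u v : R^o) t.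

(* Main.v *)
Require Import Defs.
From HB Require Import structures.
From mathcomp Require Import all_boot all_order all_algebra perm.
From mathcomp Require Import all_classical all_reals all_analysis.
From mathcomp Require Import ring lra.
Import Order.TTheory GRing.Theory Num.Theory.
Import numFieldNormedType.Exports.
Set Implicit Arguments.
Unset Strict Implicit.
Unset Printing Implicit Defensive.
Local Open Scope classical_set_scope.
Local Open Scope ring_scope.

(** All formulas come from one orientation: the metric varies on a distribution
    D1, and g_t(., v) is constant in t for v in the complement D2.  Taking
    (D1, D2) to be (Dt, D) gives the variations of Dt; exchanging the two
    distributions gives those of D.

    The orthonormal frames and the connection at time r carry no regularity
    in r, so the norms at time r are rewritten, at a point x, in the frames
    e = (e_a) of D1 and f = (f_i) of D2 of one fixed time t.  The frame f
    remains orthonormal.  The frame e acquires a Gram matrix G_r, with G_t = 1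
    and derivative (S(e_a, e_b)) at t.  Every orthonormal frame of D1 at
    time r has the form A e with A G_r A^T = 1, hence A^T A = G_r^-1
    ([change_gram_inv]).  Write h, H, T for the tensors of D1 and ht, Ht, Tt
    for those of D2.  Then |h|^2 is the sum over i of
    tr (G^-1 Psi_i G^-1 Psi_i) and |H|^2 that of (tr (G^-1 Psi_i))^2, where
    Psi_i = (g(h(e_a, e_b), f_i)), and |T|^2, |ht|^2, |Ht|^2 are similar traces
    in G_r^-1, while |Tt|^2 is the sum of the squares for g_r of the vectors
    Tt(f_i, f_j), which do not depend on r.  At r = t the matrix G_r^-1 has
    derivative - (S(e_a, e_b)).

    The connection is then removed by the Koszul formula ([koszul]): for X, Y
    in one distribution and N in the other,
      2 g(h(X, Y), N) = - (N g(X, Y) + g([X, N], Y) + g([Y, N], X)).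
    The derivative of Psi_i is therefore the same expression with S in place
    of g; this uses that d/dt commutes with the derivative along N, i.e. the
    symmetry of second derivatives ([derive_comm], [is_derive_dirder]).  When
    X, Y are in D2 the right-hand side does not depend on r at all, and neither
    do the brackets that define T, so for |ht|^2, |Ht|^2 and |T|^2 only G_r^-1
    contributes.  This yields [deriv_norm_h] to [deriv_norm_Tt].

    It remains to recognize these derivatives.  Expanding div h, K and
    div <h, S> in the frames by the Leibniz rule ([static_h], [static_H],
    [static_T]) gives traces of products of the symmetric matrices Phi_i of h,
    the skew ones of T, the skew matrices of the connection along f_i, and the
    matrix of S; the two sides agree by cyclicity of the trace and
    transposition ([variation_algebra]).  In the conformal case S is scalar on
    D1 and most of these traces vanish. *)

(** * Smooth maps between normed spaces *)

Lemma dist_triangle_half (R : realType) (p q r e : R) :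
  `|p - r| < e / 2 -> `|q - r| < e / 2 -> `|p - q| <= e.
Proof.
move=> h1 h2; rewrite (splitr e); apply: le_trans (ler_distD r _ _) _.
by apply: ltW; apply: ltrD => //; rewrite distrC.
Qed.

Section SmoothOn.
Variable R : realType.
Implicit Types V W : normedModType R.

Lemma near_eq_diff V W (f g : V -> W) (x : V) :
  (\near x, f x = g x) -> differentiable f x ->
  differentiable g x /\ 'd g x = 'd f x :> (V -> W).
Proof.
move=> fg df; have fgx := nbhs_singleton fg.
have dg : g \o shift x = cst (g x) + 'd f x +o_ 0 id.
  have /eqaddoP lf := diff_locally df; apply/eqaddoP => e e0.
  have fg0 : \forall h \near 0, f (h + x) = g (h + x).
    have [d d0 dfg] := proj1 (nbhs_ballP _ _) fg; apply/nbhs_ballP.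
    exists d => //= h; rewrite -ball_normE /= sub0r normrN => hd; apply: dfg.
    by rewrite -ball_normE /= opprD addrCA subrr addr0 normrN.
  have := lf e e0; rewrite -fgx; apply: filterS2 fg0 => h.
  by rewrite /= !fctE /= => ->.
have eqd : 'd g x = 'd f x :> (V -> W).
  by apply: diff_unique dg; apply: diff_continuous.
split=> //; apply/diff_locallyP; split; first by rewrite eqd; apply: diff_continuous.
by rewrite eqd.
Qed.

Lemma Ck_sub V W k (U U' : set V) (f : V -> W) :
  U' `<=` U -> Ck k U f -> Ck k U' f.
Proof.
elim: k f => [|k IH] f sU /=; first by move=> cf x /sU /cf.
by move=> [df Df]; split=> [x /sU /df //|v]; apply: IH.
Qed.

Lemma Ck_eq V W k (U : set V) (f g : V -> W) :
  open U -> (forall x, U x -> f x = g x) -> Ck k U f -> Ck k U g.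
Proof.
move=> oU; elim: k f g => [|k IH] f g fg /=; have nfg x : U x -> \near x, f x = g x.
- by move=> Ux; apply: filterS (open_nbhs_nbhs (conj oU Ux)) => y /fg.
- move=> cf x Ux; rewrite /prop_for /continuous_at -(fg _ Ux).
  by apply: cvg_trans (cf x Ux); apply/near_eq_cvg/nfg.
- by move=> Ux; apply: filterS (open_nbhs_nbhs (conj oU Ux)) => y /fg.
move=> [df Df]; split=> [x Ux|v].
  by have [] := near_eq_diff (nfg _ Ux) (df _ Ux).
by apply: IH (Df v) => x Ux; apply/near_eq_derive/nfg.
Qed.

Lemma smooth_on_sub V W (U U' : set V) (f : V -> W) :
  U' `<=` U -> smooth_on U f -> smooth_on U' f.
Proof. by move=> sU sf k; apply: Ck_sub (sf k). Qed.

Lemma smooth_on_eq V W (U : set V) (f g : V -> W) :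
  open U -> (forall x, U x -> f x = g x) -> smooth_on U f -> smooth_on U g.
Proof. by move=> oU fg sf k; apply: Ck_eq (sf k). Qed.

Lemma smooth_on_diff V W (U : set V) (f : V -> W) x :
  smooth_on U f -> U x -> differentiable f x.
Proof. by move=> /(_ 1%N) [df _] /df. Qed.

Lemma smooth_on_cont V W (U : set V) (f : V -> W) x :
  smooth_on U f -> U x -> {for x, continuous f}.
Proof. by move=> /(_ 0%N) cf /cf. Qed.

Lemma smooth_on_derive V W (U : set V) (f : V -> W) v :
  smooth_on U f -> smooth_on U ('D_v f : V -> W).
Proof. by move=> sf k; have [_] := sf k.+1; apply. Qed.

Lemma smooth_on_cst V W (U : set V) (w : W) : smooth_on U (fun=> w : W).
Proof.
move=> k; elim: k w => [|k IH] w /=; first by move=> x _; apply: cst_continuous.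
split=> [x _|v]; first exact: differentiable_cst.
rewrite (_ : 'D_v _ = fun=> 0) //; apply/funext => x; exact: derive_cst.
Qed.

Lemma CkD V W k (U : set V) (f g : V -> W) : open U ->
  Ck k U f -> Ck k U g -> Ck k U (fun x => f x + g x).
Proof.
move=> oU; elim: k f g => [|k IH] f g /=.
  by move=> cf cg x Ux; apply: continuousD; [apply: cf|apply: cg].
move=> [df Df] [dg Dg]; split=> [x Ux|v].
  by apply: differentiableD; [apply: df|apply: dg].
apply: (Ck_eq oU) (IH _ _ (Df v) (Dg v)) => x Ux.
by rewrite -deriveD //; apply: diff_derivable; [apply: df|apply: dg].
Qed.

Lemma smooth_onD V W (U : set V) (f g : V -> W) : open U ->
  smooth_on U f -> smooth_on U g -> smooth_on U (fun x => f x + g x).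
Proof. by move=> oU sf sg k; apply: CkD. Qed.

Lemma smooth_on_sum V W (U : set V) (I : Type) (r : seq I) (P : pred I)
    (f : I -> V -> W) : open U ->
  (forall i, P i -> smooth_on U (f i)) -> smooth_on U (fun x => \sum_(i <- r | P i) f i x).
Proof.
move=> oU sf; elim: r => [|i r IH].
  apply: (smooth_on_eq oU) (smooth_on_cst U (0 : W)) => x _; by rewrite big_nil.
case Pi : (P i); last first.
  by apply: (smooth_on_eq oU) IH => x _; rewrite big_cons Pi.
apply: (smooth_on_eq oU) (smooth_onD oU (sf i Pi) IH) => x _.
by rewrite big_cons Pi.
Qed.

(** The induction is on the order k with both factors kept smooth: the product
    rule differentiates either factor, so a hypothesis at order k alone would
    lose a derivative. *)
Lemma smooth_onM V (U : set V) (f g : V -> R^o) : open U ->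
  smooth_on U f -> smooth_on U g -> smooth_on U (fun x => f x * g x : R^o).
Proof.
move=> oU sf sg k; elim: k f g sf sg => [|k IH] f g sf sg /=.
  by move=> x Ux; apply: continuousM; [apply: smooth_on_cont sf _|apply: smooth_on_cont sg _].
split=> [x Ux|v].
  by apply: differentiableM; [apply: smooth_on_diff sf _|apply: smooth_on_diff sg _].
have sDf := smooth_on_derive v sf; have sDg := smooth_on_derive v sg.
apply: (Ck_eq oU) (CkD oU (IH _ _ sf sDg) (IH _ _ sg sDf)) => x Ux.
rewrite (deriveM (f := f) (g := g)) //; apply: diff_derivable.
  exact: (smooth_on_diff sf Ux).
exact: (smooth_on_diff sg Ux).
Qed.

Lemma smooth_on_lin V W W' (U : set V) (L : {linear W -> W'}) (f : V -> W) :
  open U -> continuous L -> smooth_on U f -> smooth_on U (L \o f).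
Proof.
move=> oU cL sf k; elim: k f sf => [|k IH] f sf /=.
  move=> x Ux; apply: continuous_comp; [exact: smooth_on_cont sf _|exact: cL].
have dLf x : U x -> differentiable (L \o f) x.
  move=> Ux; apply: differentiable_comp; first exact: (smooth_on_diff sf Ux).
  exact: linear_differentiable.
split=> [//|v]; apply: (Ck_eq oU) (IH _ (smooth_on_derive v sf)) => x Ux /=.
have dfx := smooth_on_diff sf Ux.
rewrite [RHS]deriveE; last exact: dLf.
rewrite diff_comp //; last exact: linear_differentiable.
by rewrite /= diff_lin // deriveE.
Qed.

Lemma smooth_on_coord V (U : set V) m n (f : V -> 'M[R]_(m, n)) i j :
  open U -> smooth_on U f -> smooth_on U (fun x => f x i j : R^o).
Proof.
move=> oU sf.
have @L : {linear 'M[R]_(m, n) -> R^o}.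
  by exists (fun N : 'M[R]_(_, _) => N i j); do 2![eexists]; do ?[constructor];
     rewrite ?mxE// => ? *; rewrite ?mxE//; move=> ?; rewrite !mxE.
apply: (smooth_on_lin (L := L) oU _ sf); exact: coord_continuous.
Qed.

Lemma smooth_onZl V W (U : set V) (f : V -> R^o) (w : W) :
  open U -> smooth_on U f -> smooth_on U (fun x => f x *: w).
Proof.
move=> oU sf.
have sx_lin : linear ( *:%R ^~ w : R^o -> W).
  by move=> u y z; rewrite scalerDl scalerA.
pose L : {linear _ -> _} := HB.pack ( *:%R ^~ w : R^o -> W)
  (GRing.isLinear.Build _ _ _ _ _ sx_lin).
by apply: (smooth_on_lin (L := L) oU _ sf); apply: scalel_continuous.
Qed.

Lemma smooth_on_row V (U : set V) m (f : V -> 'rV[R]_m) : open U ->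
  (forall j, smooth_on U (fun x => f x 0 j : R^o)) -> smooth_on U f.
Proof.
move=> oU sf; apply: (smooth_on_eq oU (f := fun x => \sum_j f x 0 j *: delta_mx 0 j)).
  by move=> x _; rewrite [RHS]row_sum_delta.
by apply: smooth_on_sum => // j _; apply: smooth_onZl.
Qed.

Lemma derive_slice V W (F : R^o * V -> W) (t : R) (q v : V) :
  'D_v (fun q => F (t, q)) q = 'D_(0 : R^o, v) F (t, q).
Proof.
suff e : (fun h : R => h^-1 *: (F (t, h *: v + q) - F (t, q)))
    = (fun h : R => h^-1 *: (F (h *: (0 : R^o, v) + (t : R^o, q)) - F (t, q))).
  by rewrite /derive /= e.
apply/funext => h; congr (_ *: (F _ - _)).
by congr (_, _); rewrite /= scaler0 add0r.
Qed.

Lemma smooth_on_slice V W (A : set (R^o * V)) (F : R^o * V -> W) (t : R) :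
  smooth_on A F -> smooth_on [set q | A (t, q)] (fun q => F (t, q)).
Proof.
move=> sF k; elim: k F sF => [|k IH] F sF /=.
  move=> q Aq; apply: (continuous_comp (f := fun q => (t : R^o, q))).
    by apply: differentiable_continuous; exact: differentiable_pair.
  exact: smooth_on_cont sF _.
split=> [q Aq|v].
  apply: (differentiable_comp (f := fun q => (t : R^o, q))).
    exact: differentiable_pair.
  exact: smooth_on_diff sF _.
rewrite (_ : 'D_v _ = fun q => 'D_(0 : R^o, v) F (t, q)); last first.
  by apply/funext => q; apply: derive_slice.
exact: (IH ('D_(0 : R^o, v) F) (smooth_on_derive (0 : R^o, v) sF)).
Qed.

Lemma derive_slice_time V W (F : R^o * V -> W) (t : R) (q : V) :
  'D_(1 : R^o) (fun r : R^o => F (r, q)) (t : R^o) = 'D_(1 : R^o, 0 : V) F (t, q).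
Proof.
suff e : (fun h : R => h^-1 *: (F ((h *: (1 : R^o) + t) : R^o, q) - F (t, q)))
    = (fun h : R => h^-1 *: (F (h *: (1 : R^o, 0 : V) + (t : R^o, q)) - F (t, q))).
  by rewrite /derive /= e.
apply/funext => h; congr (_ *: (F _ - _)).
by congr (_, _); rewrite /= scaler0 add0r.
Qed.

Lemma derivable_slice_time V W (F : R^o * V -> W) (t : R) (q : V) :
  differentiable F (t : R^o, q) ->
  derivable (fun r : R^o => F (r, q)) (t : R^o) (1 : R^o).
Proof.
move=> dF; apply/diff_derivable.
by apply: (differentiable_comp (f := fun r : R^o => (r, q))) => //; apply: differentiable_pair.
Qed.

Lemma is_derive_line V W (f : V -> W) (x u : V) (a : R) :
  derivable f (x + a *: u) u ->
  is_derive (a : R^o) (1 : R^o) (fun a : R^o => f (x + a *: u)) ('D_u f (x + a *: u)).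
Proof.
have e : (fun h : R => h^-1 *: (f (x + ((h *: (1 : R^o) + a) : R^o) *: u) - f (x + a *: u)))
    = (fun h : R => h^-1 *: (f (h *: u + (x + a *: u)) - f (x + a *: u))).
  apply/funext => h; congr (_ *: (f _ - _)).
  by rewrite [h *: 1]mulr1 scalerDl addrCA.
by move=> df; split; rewrite /derivable /derive /= e.
Qed.

(** The mean value theorem in each variable in turn turns the second difference
    over a small parallelogram into a mixed second derivative at one of its
    points. *)
Lemma second_difference V (U : set V) (f : V -> R^o) (x u v : V) (s : R) :
  open U -> smooth_on U f -> 0 < s ->
  (forall a b, 0 <= a <= s -> 0 <= b <= s -> U (x + a *: u + b *: v)) ->
  exists a b, [/\ 0 <= a <= s, 0 <= b <= s &
    f (x + s *: u + s *: v) - f (x + s *: u) - f (x + s *: v) + f x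
    = s * s * 'D_v ('D_u f : V -> R^o) (x + a *: u + b *: v)].
Proof.
move=> oU sf s0 box.
have s0' : 0 <= s <= s by rewrite (ltW s0) lexx.
have z0' : 0 <= (0 : R) <= s by rewrite (ltW s0) lexx.
pose phi (a : R) := f ((x + s *: v) + a *: u) - f (x + a *: u).
pose dphi (a : R) := 'D_u f ((x + s *: v) + a *: u) - 'D_u f (x + a *: u).
have dphiP (a : R) : 0 <= a <= s -> is_derive (a : R^o) (1 : R^o) (phi : R^o -> R^o) (dphi a).
  move=> ha; apply: is_deriveB; apply: is_derive_line; apply: diff_derivable;
    apply: smooth_on_diff sf _.
    by rewrite addrAC; apply: box.
  by rewrite -[x + a *: u]addr0 -(scale0r v); apply: box.
have [a /= ha ea] : exists2 a : R, a \in `[0, s]%R & phi s - phi 0 = dphi a * (s - 0).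
  apply: MVT_segment => [|y /andP[y0 ys]|]; first exact: ltW.
    by apply: dphiP; rewrite !bnd_simp in y0 ys; rewrite !ltW.
  apply: derivable_within_continuous => y; rewrite in_itv /= => hy.
  by have [] := dphiP y hy.
move: ha; rewrite in_itv /= => ha.
pose psi (b : R) := 'D_u f ((x + a *: u) + b *: v).
have dpsiP (b : R) : 0 <= b <= s -> is_derive (b : R^o) (1 : R^o) (psi : R^o -> R^o)
     ('D_v ('D_u f : V -> R^o) ((x + a *: u) + b *: v)).
  move=> hb; apply: is_derive_line; apply: diff_derivable.
  by apply: smooth_on_diff (smooth_on_derive u sf) _; apply: box.
have [b /= hb eb] : exists2 b : R, b \in `[0, s]%R & psi s - psi 0 =
    'D_v ('D_u f : V -> R^o) ((x + a *: u) + b *: v) * (s - 0).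
  apply: (MVT_segment (df := fun b => 'D_v ('D_u f : V -> R^o) ((x + a *: u) + b *: v)))
    => [|y /andP[y0 ys]|]; first exact: ltW.
    by apply: dpsiP; rewrite !bnd_simp in y0 ys; rewrite !ltW.
  apply: derivable_within_continuous => y; rewrite in_itv /= => hy.
  by have [] := dpsiP y hy.
move: hb; rewrite in_itv /= => hb.
exists a, b; split=> //.
move: ea eb; rewrite /phi /dphi /psi !subr0 !scale0r !addr0 => ea eb.
rewrite -mulrA [X in _ = s * X]mulrC -eb [x + a *: u + s *: v]addrAC mulrC -ea.
by rewrite [x + s *: v + s *: u]addrAC opprB addrA [LHS]addrAC.
Qed.

(** Symmetry of second derivatives: the second difference is symmetric in u and
    v, so [second_difference] gives equal values of the two mixed derivatives at
    two points close to x; both are continuous. *)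
Lemma derive_comm V (U : set V) (f : V -> R^o) (x u v : V) :
  open U -> smooth_on U f -> U x ->
  'D_u ('D_v f : V -> R^o) x = 'D_v ('D_u f : V -> R^o) x.
Proof.
move=> oU sf Ux.
set P := 'D_u ('D_v f : V -> R^o); set Q := 'D_v ('D_u f : V -> R^o).
have cP : {for x, continuous P}.
  by apply: smooth_on_cont Ux; do 2!apply: smooth_on_derive.
have cQ : {for x, continuous Q}.
  by apply: smooth_on_cont Ux; do 2!apply: smooth_on_derive.
apply/eqP; rewrite -subr_eq0 -normr_le0; apply/ler_addgt0Pr => e e0; rewrite add0r.
have e20 : 0 < e / 2 by rewrite divr_gt0.
have nU := open_nbhs_nbhs (conj oU Ux).
have nP : \forall y \near x, `|P x - P y| < e / 2 by apply: cvgr_dist_lt cP _ e20.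
have nQ : \forall y \near x, `|Q x - Q y| < e / 2 by apply: cvgr_dist_lt cQ _ e20.
have [d /= d0 hd] := proj1 (nbhs_ballP _ _) (filterI nU (filterI nP nQ)).
set K := `|u| + `|v| + 1; have K0 : 0 < K by rewrite ltr_wpDl // addr_ge0.
(* the parallelogram of side s spanned by u and v lies in the ball of radius d *)
pose s := d / K / 2; have s0 : 0 < s by rewrite !divr_gt0.
have near_x a b : 0 <= a <= s -> 0 <= b <= s -> ball x d (x + a *: u + b *: v).
  move=> /andP[a0 la] /andP[b0 lb]; rewrite -ball_normE /=.
  rewrite -addrA opprD addrA subrr sub0r normrN.
  apply: (@le_lt_trans _ _ (s * (`|u| + `|v|))).
    apply: le_trans (ler_normD _ _) _; rewrite mulrDr !normrZ lerD //.
      by rewrite ler_wpM2r // ger0_norm.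
    by rewrite ler_wpM2r // ger0_norm.
  apply: (@lt_le_trans _ _ (s * K)); first by rewrite ltr_pM2l // ltrDl.
  by rewrite /s mulrAC divfK ?gt_eqF // ler_pdivrMr // ler_peMr ?ltW // ltr1n.
have box a b : 0 <= a <= s -> 0 <= b <= s -> U (x + a *: u + b *: v).
  by move=> ha hb; have [] := hd _ (near_x a b ha hb).
have box' a b : 0 <= a <= s -> 0 <= b <= s -> U (x + a *: v + b *: u).
  by move=> ha hb; rewrite addrAC; apply: box.
have [a [b [ha hb e1]]] := second_difference oU sf s0 box.
have [a' [b' [ha' hb' e2]]] := second_difference oU sf s0 box'.
have ePQ : P (x + b' *: u + a' *: v) = Q (x + a *: u + b *: v).
  rewrite (addrAC x (b' *: u)).
  have ss0 : s * s != 0 by rewrite mulf_neq0 // gt_eqF.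
  suff : s * s * P (x + a' *: v + b' *: u) = s * s * Q (x + a *: u + b *: v) :> R.
    by move/(mulfI ss0).
  apply: etrans (esym e2) _; apply: etrans _ e1.
  by rewrite (addrAC x (s *: v)); congr (_ + _); rewrite [LHS]addrAC.
have [_ [_ /= hQ]] := hd _ (near_x a b ha hb).
have [_ [/= hP _]] := hd _ (near_x b' a' hb' ha').
rewrite ePQ in hP.
exact: (dist_triangle_half hP hQ).
Qed.

End SmoothOn.

(** * Smooth functions and vector fields on a manifold *)

Lemma smooth_on_snd (R : realType) (V W : normedModType R) (A : set (R^o * V)) (B : set V)
    (f : V -> W) :
  (forall z, A z -> B z.2) -> smooth_on B f -> smooth_on A (fun z => f z.2).
Proof.
move=> AB sf k; elim: k f sf => [|k IH] f sf /=.
  move=> [t q] /AB /= Bq; apply: continuous_comp; first exact: cvg_snd.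
  exact: (smooth_on_cont sf Bq).
split=> [[t q] /AB /= Bq|v].
  apply: (differentiable_comp (f := snd)); last exact: (smooth_on_diff sf Bq).
  have cs : continuous (snd : {linear (R^o * V)%type -> V}) by move=> z; apply: cvg_snd.
  exact: (linear_differentiable (t : R^o, q) cs).
rewrite (_ : 'D_v _ = fun z => ('D_(v.2) f) z.2) //.
exact: (IH _ (smooth_on_derive v.2 sf)).
Qed.

(** Chain rule for a local left inverse. *)
Lemma diff_cancel (R : realType) (V W : normedModType R) (A : W -> V) (B : V -> W)
    (q v : V) :
  differentiable B q -> differentiable A (B q) -> (\forall p \near q, A (B p) = p) ->
  'd A (B q) ('d B q v) = v.
Proof.
move=> dB dA AB.
have [_ e] := near_eq_diff (f := A \o B) (g := id) AB (differentiable_comp dB dA).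
have dc := diff_comp dB dA.
transitivity ('d (A \o B) q v); first by rewrite dc.
by rewrite -e diff_val.
Qed.

Section Manifold.
Variables (R : realType) (m : nat) (M : manifold R m).
Implicit Types (X Y Z : vfield M) (U : set M) (f : M -> R) (S : tensor2 M).

Lemma dom_param (x : M) q : (chart x @` dom x) q -> dom x (param x q).
Proof. by move=> [z xz <-]; rewrite chartK. Qed.

Lemma param_chart (x : M) q : (chart x @` dom x) q -> chart x (param x q) = q.
Proof. by move=> [z xz <-]; rewrite chartK. Qed.

Lemma chart_img_sub (x : M) U q :
  (chart x @` (dom x `&` U)) q -> (chart x @` dom x) q /\ U (param x q).
Proof. by move=> [z [xz Uz] <-]; split; [exists z|rewrite chartK]. Qed.

Lemma chart_img (x : M) U q :
  (chart x @` dom x) q -> U (param x q) -> (chart x @` (dom x `&` U)) q.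
Proof. by move=> [z xz <-]; rewrite chartK // => Uz; exists z. Qed.

Lemma near_param (x z : M) (P : set M) : dom x z -> (\forall y \near z, P y) ->
  \forall q \near chart x z, (chart x @` dom x) q /\ P (param x q).
Proof.
move=> xz Pz.
have xq : (chart x @` dom x) (chart x z) by exists z.
have n1 := open_nbhs_nbhs (conj (@codom_open _ _ M x) xq).
apply: (filterI n1).
by have := param_continuous xq; rewrite /prop_for /continuous_at chartK //; apply.
Qed.

Lemma open_chart_img (x : M) U : open U -> open (chart x @` (dom x `&` U)).
Proof.
move=> oU; rewrite openE => q [z [xz Uz] <-].
have := near_param xz (open_nbhs_nbhs (conj oU Uz)).
by apply: filterS => q' [xq' Uq']; apply: chart_img.
Qed.

Lemma self_chart_img (x : M) U : U x -> (chart x @` (dom x `&` U)) (chart x x).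
Proof. by move=> Ux; exists x => //; split=> //; apply: dom_self. Qed.

Lemma transition_diff (x y z : M) : dom x z -> dom y z ->
  differentiable (chart y \o param x) (chart x z).
Proof.
move=> xz yz; apply: (smooth_on_diff (@transition_smooth _ _ M x y)).
by exists z.
Qed.

(** The two changes of chart are mutually inverse diffeomorphisms near z, so this
    is the chain rule. *)
Lemma change_chartK (x y z : M) v : dom x z -> dom y z ->
  change_chart x y z (change_chart y x z v) = v.
Proof.
move=> xz yz; rewrite /change_chart.
(* the differential of the second map is taken at the image of chart y z *)
have e0 : chart x z = (chart x \o param y) (chart y z) by rewrite /= chartK.
rewrite e0; apply: diff_cancel.
- exact: transition_diff.
- by rewrite -e0; exact: transition_diff.
have nx : \forall w \near z, dom x w by apply: (open_nbhs_nbhs (conj (dom_open x) xz)).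
apply: filterS (near_param yz nx) => q [yq xq] /=.
by rewrite chartK // param_chart.
Qed.

Lemma change_chart_id (x : M) v : change_chart x x x v = v.
Proof.
have xx := @dom_self _ _ _ x.
have nid : \forall q \near chart x x, id q = (chart x \o param x) q.
  have nx : \forall w \near x, dom x w by apply: (open_nbhs_nbhs (conj (dom_open x) xx)).
  by apply: filterS (near_param xx nx) => q [xq _] /=; rewrite param_chart.
have [_ e] := near_eq_diff nid (ex_diff (f := id)).
by rewrite /change_chart e diff_val.
Qed.

Lemma smooth_fun_sub U U' f : U' `<=` U -> smooth_fun U f -> smooth_fun U' f.
Proof.
by move=> sU sf x; apply: smooth_on_sub (sf x) => q [z [xz Uz] <-]; exists z => //; split=> //; apply: sU.
Qed.

Lemma smooth_vf_sub U U' X : U' `<=` U -> smooth_vf U X -> smooth_vf U' X.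
Proof.
by move=> sU sf x; apply: smooth_on_sub (sf x) => q [z [xz Uz] <-]; exists z => //; split=> //; apply: sU.
Qed.

Lemma smooth_fun_eq U f h : open U -> (forall y, U y -> f y = h y) ->
  smooth_fun U f -> smooth_fun U h.
Proof.
move=> oU e sf x; apply: smooth_on_eq (sf x); first exact: open_chart_img.
by move=> q /chart_img_sub[_ Uq] /=; rewrite e.
Qed.

Lemma smooth_vf_eq U X Y : open U -> (forall y, U y -> X y = Y y) ->
  smooth_vf U X -> smooth_vf U Y.
Proof.
move=> oU e sf x; apply: smooth_on_eq (sf x); first exact: open_chart_img.
by move=> q /chart_img_sub[_ Uq] /=; rewrite /incoord e.
Qed.

Lemma smooth_fun_cst U (a : R) : smooth_fun U (fun=> a).
Proof. move=> x; exact: smooth_on_cst. Qed.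

Lemma smooth_funD U f h : open U -> smooth_fun U f -> smooth_fun U h ->
  smooth_fun U (fun y => f y + h y).
Proof. by move=> oU sf sh x; apply: smooth_onD => //; apply: open_chart_img. Qed.

Lemma smooth_funM U f h : open U -> smooth_fun U f -> smooth_fun U h ->
  smooth_fun U (fun y => f y * h y).
Proof.
move=> oU sf sh x.
exact: (smooth_onM (@open_chart_img x _ oU) (sf x) (sh x)).
Qed.

Lemma smooth_vfD U X Y : open U -> smooth_vf U X -> smooth_vf U Y ->
  smooth_vf U (fun y => X y + Y y).
Proof.
move=> oU sf sh x; have oW := @open_chart_img x _ oU.
apply: smooth_on_eq oW _ (smooth_onD oW (sf x) (sh x)).
by move=> q _; rewrite /incoord /change_chart linearD.
Qed.

Lemma smooth_vfZ U f X : open U -> smooth_fun U f -> smooth_vf U X ->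
  smooth_vf U (fun y => f y *: X y).
Proof.
move=> oU sf sX x; have oW := @open_chart_img x _ oU.
apply: smooth_on_row => // j.
apply: smooth_on_eq oW _ (smooth_onM oW (sf x) (smooth_on_coord 0 j oW (sX x))).
by move=> q _; rewrite /incoord /change_chart linearZ /= mxE.
Qed.

Lemma smooth_vf0 U : smooth_vf U (fun=> 0).
Proof.
move=> x k; have := @smooth_on_cst R _ _ (chart x @` (dom x `&` U)) (0 : 'rV[R]_m) k.
congr Ck; apply/funext => q; by rewrite /incoord /change_chart linear0.
Qed.

Lemma smooth_vf_nearP (x : M) U X : open U -> U x -> smooth_vf U X -> smooth_vf_near x X.
Proof. by move=> oU Ux sf; exists U. Qed.

Lemma near_openP (x : M) (P : set M) : (\forall y \near x, P y) ->
  exists2 U, open_nbhs x U & forall y, U y -> P y.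
Proof. by move=> nP; have : nbhs x P by []; rewrite nbhsE => -[U oU sU]; exists U. Qed.

Lemma smooth_fun_near_eq (x : M) f h :
  (\forall y \near x, f y = h y) -> smooth_fun_near x f -> smooth_fun_near x h.
Proof.
move=> /near_openP[U [oU Ux] e] [U' [oU' U'x] sf].
exists (U `&` U'); first by split; [exact: openI|].
apply: (@smooth_fun_eq _ f) => [|y [/e //]|]; first exact: openI.
by apply: smooth_fun_sub sf => y [].
Qed.

Lemma smooth_vf_near_eq (x : M) X Y :
  (\forall y \near x, X y = Y y) -> smooth_vf_near x X -> smooth_vf_near x Y.
Proof.
move=> /near_openP[U [oU Ux] e] [U' [oU' U'x] sf].
exists (U `&` U'); first by split; [exact: openI|].
apply: (@smooth_vf_eq _ X) => [|y [/e //]|]; first exact: openI.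
by apply: smooth_vf_sub sf => y [].
Qed.

Lemma smooth_fun_near_cst (x : M) (a : R) : smooth_fun_near x (fun=> a).
Proof. by exists setT; [split=> //; exact: openT|exact: smooth_fun_cst]. Qed.

Lemma smooth_fun_nearD (x : M) f h : smooth_fun_near x f -> smooth_fun_near x h ->
  smooth_fun_near x (fun y => f y + h y).
Proof.
move=> [U [oU Ux] sf] [U' [oU' U'x] sh]; exists (U `&` U'); first by split; [exact: openI|].
apply: smooth_funD; first exact: openI.
  by apply: smooth_fun_sub sf => y [].
by apply: smooth_fun_sub sh => y [].
Qed.

Lemma smooth_fun_nearM (x : M) f h : smooth_fun_near x f -> smooth_fun_near x h ->
  smooth_fun_near x (fun y => f y * h y).
Proof.
move=> [U [oU Ux] sf] [U' [oU' U'x] sh]; exists (U `&` U'); first by split; [exact: openI|].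
apply: smooth_funM; first exact: openI.
  by apply: smooth_fun_sub sf => y [].
by apply: smooth_fun_sub sh => y [].
Qed.

Lemma smooth_vf_nearD (x : M) X Y : smooth_vf_near x X -> smooth_vf_near x Y ->
  smooth_vf_near x (fun y => X y + Y y).
Proof.
move=> [U [oU Ux] sf] [U' [oU' U'x] sh]; exists (U `&` U'); first by split; [exact: openI|].
apply: smooth_vfD; first exact: openI.
  by apply: smooth_vf_sub sf => y [].
by apply: smooth_vf_sub sh => y [].
Qed.

Lemma smooth_vf_nearZ (x : M) f X : smooth_fun_near x f -> smooth_vf_near x X ->
  smooth_vf_near x (fun y => f y *: X y).
Proof.
move=> [U [oU Ux] sf] [U' [oU' U'x] sh]; exists (U `&` U'); first by split; [exact: openI|].
apply: smooth_vfZ; first exact: openI.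
  by apply: smooth_fun_sub sf => y [].
by apply: smooth_vf_sub sh => y [].
Qed.

Lemma smooth_vf_near0 (x : M) : smooth_vf_near x (fun=> 0).
Proof. by exists setT; [split=> //; exact: openT|exact: smooth_vf0]. Qed.

Lemma smooth_fun_near_sum (x : M) (I : Type) (r : seq I) (f : I -> M -> R) :
  (forall i, smooth_fun_near x (f i)) -> smooth_fun_near x (fun y => \sum_(i <- r) f i y).
Proof.
move=> sf; elim: r => [|i r IH].
  by apply: smooth_fun_near_eq (smooth_fun_near_cst x 0); apply: nearW => y; rewrite big_nil.
apply: smooth_fun_near_eq (smooth_fun_nearD (sf i) IH).
by apply: nearW => y; rewrite big_cons.
Qed.

Lemma smooth_vf_near_sum (x : M) (I : Type) (r : seq I) (X : I -> vfield M) :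
  (forall i, smooth_vf_near x (X i)) -> smooth_vf_near x (fun y => \sum_(i <- r) X i y).
Proof.
move=> sf; elim: r => [|i r IH].
  by apply: smooth_vf_near_eq (smooth_vf_near0 x); apply: nearW => y; rewrite big_nil.
apply: smooth_vf_near_eq (smooth_vf_nearD (sf i) IH).
by apply: nearW => y; rewrite big_cons.
Qed.

Lemma smooth_fun_near_diff (x : M) f : smooth_fun_near x f ->
  differentiable (f \o param x : _ -> R^o) (chart x x).
Proof.
move=> [U [oU Ux] sf]; apply: (smooth_on_diff (sf x)); exact: self_chart_img.
Qed.

(** Directional derivatives are local; most uses replace a function by a constant
    that it equals near x, such as the product of two frame fields. *)
Lemma dirder_near_eq (x : M) v f h : (\forall y \near x, f y = h y) ->
  dirder x v f = dirder x v h.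
Proof.
move=> e; apply: near_eq_derive.
by apply: filterS (near_param (dom_self x) e) => q [_ /= ->].
Qed.

Lemma dirder_cst (x : M) v (a : R) : dirder x v (fun=> a) = 0.
Proof. exact: derive_cst. Qed.

Lemma dirderD (x : M) v f h : smooth_fun_near x f -> smooth_fun_near x h ->
  dirder x v (fun y => f y + h y) = dirder x v f + dirder x v h.
Proof.
move=> /smooth_fun_near_diff df /smooth_fun_near_diff dh.
by rewrite /dirder -deriveD //; apply: diff_derivable.
Qed.

Lemma dirder_sum (x : M) v (I : Type) (r : seq I) (f : I -> M -> R) :
  (forall i, smooth_fun_near x (f i)) ->
  dirder x v (fun y => \sum_(i <- r) f i y) = \sum_(i <- r) dirder x v (f i).
Proof.
move=> sf; elim: r => [|i r IH].
  rewrite big_nil -[RHS](dirder_cst x v 0).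
  by apply: dirder_near_eq; apply: nearW => y; rewrite big_nil.
rewrite big_cons -IH -dirderD //; last exact: smooth_fun_near_sum.
by apply: dirder_near_eq; apply: nearW => y; rewrite big_cons.
Qed.

Lemma dirder_lin (x : M) f (a : R) u v : smooth_fun_near x f ->
  dirder x (a *: u + v) f = a * dirder x u f + dirder x v f.
Proof.
move=> /smooth_fun_near_diff df.
by rewrite /dirder !deriveE // linearP.
Qed.

Lemma dirder_sumv (x : M) f (I : Type) (r : seq I) (a : I -> R) (u : I -> 'rV[R]_m) :
  smooth_fun_near x f ->
  dirder x (\sum_(i <- r) a i *: u i) f = \sum_(i <- r) a i * dirder x (u i) f.
Proof.
move=> sf; elim: r => [|i r IH]; last by rewrite !big_cons dirder_lin // IH.
by rewrite !big_nil /dirder derive0.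
Qed.

Section SymTensor.
Variables (S : tensor2 M) (U : set M) (x : M).
Hypotheses (symS : symmetric_tensor U S) (Ux : U x).

Lemma tensorC u v : S x u v = S x v u.
Proof. by have [+ _] := symS Ux; apply. Qed.
Lemma tensor_linl a u v w : S x (a *: u + v) w = a * S x u w + S x v w.
Proof. by have [_] := symS Ux; apply. Qed.
Lemma tensor0l w : S x 0 w = 0.
Proof. by have := tensor_linl (-1) 0 0 w; rewrite scaler0 addr0 mulN1r addNr. Qed.
Lemma tensorDl u v w : S x (u + v) w = S x u w + S x v w.
Proof. by have := tensor_linl 1 u v w; rewrite scale1r mul1r. Qed.
Lemma tensorZl a u w : S x (a *: u) w = a * S x u w.
Proof. by rewrite -[a *: u]addr0 tensor_linl tensor0l addr0. Qed.
Lemma tensorNl u w : S x (- u) w = - S x u w.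
Proof. by rewrite -scaleN1r tensorZl mulN1r. Qed.
Lemma tensorBl u v w : S x (u - v) w = S x u w - S x v w.
Proof. by rewrite tensorDl tensorNl. Qed.
Lemma tensor_suml (I : Type) (r : seq I) (P : pred I) (F : I -> 'rV_m) w :
  S x (\sum_(i <- r | P i) F i) w = \sum_(i <- r | P i) S x (F i) w.
Proof.
by elim/big_rec2: _ => [|i y1 y2 _ IH]; rewrite ?tensor0l // tensorDl IH.
Qed.
Lemma tensorZr a w u : S x w (a *: u) = a * S x w u.
Proof. by rewrite tensorC tensorZl (tensorC w). Qed.
Lemma tensor_sumr (I : Type) (r : seq I) (P : pred I) (F : I -> 'rV_m) w :
  S x w (\sum_(i <- r | P i) F i) = \sum_(i <- r | P i) S x w (F i).
Proof. by rewrite tensorC tensor_suml; apply: eq_bigr => i _; rewrite tensorC. Qed.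
End SymTensor.

(** * Smooth families of metrics *)

Section Family.
Variables (eps : R) (g : R -> tensor2 M).
Hypothesis g_smooth : smooth_family eps g.
Hypothesis g_sym : forall t, `|t| < eps -> symmetric_tensor setT (g t).

Definition time_space (W : set 'rV[R]_m) : set (R^o * 'rV[R]_m) :=
  [set z | `|z.1 : R| < eps /\ W z.2].

Lemma open_time_space W : open W -> open (time_space W).
Proof.
move=> oW; have -> : time_space W = (fst @^-1` [set t : R^o | `|t : R| < eps]) `&` (snd @^-1` W).
  by apply/seteqP; split.
apply: openI; apply: open_comp => //.
- by move=> z _; apply: cvg_fst.
- rewrite (_ : [set t | _] = ball (0 : R^o) eps); first exact: ball_open.
  by apply/seteqP; split=> t /=; rewrite -ball_normE /= sub0r normrN.
- by move=> z _; apply: cvg_snd.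
Qed.

(** In a chart, g_t(X, Y) is a polynomial in the components of X and Y and the
    components of g_t, all jointly smooth in time and space. *)
Lemma smooth_family_fields U X Y (x : M) : open U -> smooth_vf U X -> smooth_vf U Y ->
  smooth_on (time_space (chart x @` (dom x `&` U)))
    (fun z => on_fields (g z.1) X Y (param x z.2) : R^o).
Proof.
move=> oU sX sY; set W := chart x @` _.
have oW : open W by apply: open_chart_img.
have oA := open_time_space oW.
pose F i j (z : R^o * 'rV[R]_m) : R^o :=
  incoord x X z.2 0 i * incoord x Y z.2 0 j
  * tensor_incoord x (g z.1) (delta_mx 0 i) (delta_mx 0 j) z.2.
apply: (smooth_on_eq oA (f := fun z => \sum_i \sum_j F i j z)).
  move=> [t q] [/= ht /chart_img_sub[xq Uq]]; rewrite /on_fields.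
  have sg := g_sym ht.
  have e Z : change_chart x (param x q) (param x q) (incoord x Z q) = Z (param x q).
    by rewrite /incoord change_chartK //; [exact: dom_param|exact: dom_self].
  rewrite -(e X) -(e Y) (row_sum_delta (incoord x X q)) (row_sum_delta (incoord x Y q)).
  rewrite /change_chart !linear_sum /= (tensor_suml sg I).
  apply: eq_bigr => i _; rewrite (tensor_sumr sg I); apply: eq_bigr => j _.
  rewrite !linearZ /= (tensorZl sg I) (tensorZr sg I) /F /tensor_incoord /=.
  by rewrite mulrA.
apply: smooth_on_sum => // i _; apply: smooth_on_sum => // j _.
apply: (smooth_onM oA).
  apply: (smooth_onM oA).
    apply: (smooth_on_snd (B := W) (f := fun q => incoord x X q 0 i : R^o)) => [z []//|].
    exact: (smooth_on_coord _ _ oW (sX x)).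
  apply: (smooth_on_snd (B := W) (f := fun q => incoord x Y q 0 j : R^o)) => [z []//|].
  exact: (smooth_on_coord _ _ oW (sY x)).
apply: smooth_on_sub (@g_smooth x (delta_mx 0 i) (delta_mx 0 j)) => z [ht /chart_img_sub[]].
by [].
Qed.

Lemma smooth_metric t U X Y : `|t| < eps -> open U -> smooth_vf U X -> smooth_vf U Y ->
  smooth_fun U (on_fields (g t) X Y).
Proof.
move=> ht oU sX sY x; have := smooth_on_slice t (smooth_family_fields x oU sX sY).
by apply: smooth_on_sub => q Wq.
Qed.

Lemma is_derive_family t (x : M) u v : `|t| < eps ->
  is_derive (t : R^o) (1 : R^o) (fun r : R^o => g r x u v : R^o) (dt_metric g t x u v).
Proof.
move=> ht; have xx := @dom_self _ _ _ x.
have h : derivable (fun r : R^o => g r x u v : R^o) (t : R^o) (1 : R^o).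
  have e : (fun r : R^o => g r x u v : R^o)
      = (fun r : R^o => tensor_incoord x (g r) u v (chart x x) : R^o).
    apply/funext => r; rewrite /tensor_incoord /= chartK //.
    by rewrite !change_chart_id.
  rewrite e; apply: (derivable_slice_time
    (F := fun z : R^o * 'rV[R]_m => tensor_incoord x (g z.1) u v z.2 : R^o)).
  by apply: (smooth_on_diff (@g_smooth x u v)); split=> //; exists x.
by split=> //; rewrite /dt_metric derive1E.
Qed.

(** S(X, Y) is the time derivative of a function that is jointly smooth in time
    and space; this is why S is smooth, and why it can be differentiated along M. *)
Lemma dt_metric_fieldsE t X Y (x : M) q : `|t| < eps -> 
  'D_(1 : R^o, 0 : 'rV[R]_m) (fun z : R^o * 'rV[R]_m =>
     on_fields (g z.1) X Y (param x z.2) : R^o) (t, q)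
  = on_fields (dt_metric g t) X Y (param x q).
Proof.
move=> ht; rewrite -derive_slice_time /=.
by have [_] := is_derive_family (param x q) (X (param x q)) (Y (param x q)) ht.
Qed.

Lemma smooth_dt_metric t U X Y : `|t| < eps -> open U -> smooth_vf U X -> smooth_vf U Y ->
  smooth_fun U (on_fields (dt_metric g t) X Y).
Proof.
move=> ht oU sX sY x.
have := smooth_on_slice t
  (smooth_on_derive (1 : R^o, 0 : 'rV[R]_m) (smooth_family_fields x oU sX sY)).
move=> s; apply: smooth_on_eq (@open_chart_img x _ oU) _ (smooth_on_sub _ s).
  by move=> q _; rewrite dt_metric_fieldsE.
by move=> q Wq.
Qed.

Lemma dt_metric_sym t : `|t| < eps -> symmetric_tensor setT (dt_metric g t).
Proof.
move=> ht x _.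
have near_t : \forall r \near (t : R^o), `|r : R| < eps.
  have := @ball_open _ R^o (0 : R^o) eps; rewrite openE => /(_ t).
  rewrite /interior -ball_normE /= sub0r normrN => /(_ ht).
  by apply: filterS => r; rewrite /= sub0r normrN.
split=> [u v|a u v w].
  rewrite /dt_metric !derive1E; apply: near_eq_derive.
  by apply: filterS near_t => r /g_sym sg; rewrite (tensorC sg I).
have d1 := is_derive_family x u w ht; have d2 := is_derive_family x v w ht.
have d3 : is_derive (t : R^o) (1 : R^o)
   (fun r : R^o => a *: (g r x u w : R^o) + g r x v w : R^o)
   (a *: (dt_metric g t x u w : R^o) + dt_metric g t x v w).
  exact: is_deriveD.
have := is_derive_family x (a *: u + v) w ht.
have d4 : is_derive (t : R^o) (1 : R^o)
   (fun r : R^o => g r x (a *: u + v) w : R^o) (a * dt_metric g t x u w + dt_metric g t x v w).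
  apply: near_eq_is_derive d3.
  by apply: filterS near_t => r /g_sym sg; rewrite (tensor_linl sg I).
by move=> [_ <-]; have [_ <-] := d4.
Qed.

(** d/dt (v g_t(X, Y)) = v S(X, Y): the time and space derivatives of a jointly
    smooth function commute. *)
Lemma is_derive_dirder t (x : M) v X Y : `|t| < eps ->
  smooth_vf_near x X -> smooth_vf_near x Y ->
  is_derive (t : R^o) (1 : R^o) (fun r : R^o => dirder x v (on_fields (g r) X Y) : R^o)
    (dirder x v (on_fields (dt_metric g t) X Y)).
Proof.
move=> ht [U [oU Ux] sX] [U' [oU' U'x] sY].
have oUU := openI oU oU'.
have {}sX : smooth_vf (U `&` U') X by apply: smooth_vf_sub sX => y [].
have {}sY : smooth_vf (U `&` U') Y by apply: smooth_vf_sub sY => y [].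
have Wx := @self_chart_img x (U `&` U') (conj Ux U'x).
have sF := smooth_family_fields x oUU sX sY.
set F := (fun z : R^o * 'rV[R]_m => _) in sF.
have oA := open_time_space (@open_chart_img x _ oUU).
have tx : time_space (chart x @` (dom x `&` (U `&` U'))) (t, chart x x) by split.
have e : (fun r : R^o => dirder x v (on_fields (g r) X Y) : R^o)
   = (fun r : R^o => 'D_(0 : R^o, v) F (r, chart x x)).
  by apply/funext => r; rewrite -derive_slice.
rewrite e; split.
  apply: (derivable_slice_time (F := 'D_(0 : R^o, v) F : R^o * 'rV[R]_m -> R^o)).
  exact: (smooth_on_diff (smooth_on_derive (0 : R^o, v) sF) tx).
transitivity ('D_(1 : R^o, 0 : 'rV[R]_m) ('D_(0 : R^o, v) F : R^o * 'rV[R]_m -> R^o)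
    (t : R^o, chart x x)).
  exact: (derive_slice_time ('D_(0 : R^o, v) F : R^o * 'rV[R]_m -> R^o)).
transitivity ('D_(0 : R^o, v) ('D_(1 : R^o, 0 : 'rV[R]_m) F : R^o * 'rV[R]_m -> R^o)
    (t : R^o, chart x x)).
  exact: (derive_comm _ _ oA sF tx).
rewrite -derive_slice /dirder.
have -> : (fun q => 'D_(1 : R^o, 0 : 'rV[R]_m) F (t : R^o, q))
    = (on_fields (dt_metric g t) X Y \o param x : _ -> R^o).
  by apply/funext => q; exact: (dt_metric_fieldsE X Y x q ht).
by [].
Qed.

End Family.
End Manifold.

(** * Connections *)

Section Connection.
Variables (R : realType) (m : nat) (M : manifold R m) (nabla : connection M).
Hypothesis nablaC : is_connection nabla.
Implicit Types (X Y Z : vfield M) (f : M -> R) (x : M).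

Lemma nablaD x v Y Z : smooth_vf_near x Y -> smooth_vf_near x Z ->
  nabla x v (fun y => Y y + Z y) = nabla x v Y + nabla x v Z.
Proof. by have [_ + _ _] := nablaC; apply. Qed.

Lemma nablaZ x v f Y : smooth_fun_near x f -> smooth_vf_near x Y ->
  nabla x v (fun y => f y *: Y y) = dirder x v f *: Y x + f x *: nabla x v Y.
Proof. by have [_ _ + _] := nablaC; apply. Qed.

Lemma nabla_linv x a u v Y : smooth_vf_near x Y ->
  nabla x (a *: u + v) Y = a *: nabla x u Y + nabla x v Y.
Proof. by have [+ _ _ _] := nablaC; apply. Qed.

(** If Y vanishes near x then Y = f Y for the function f equal to 0 where Y vanishes
    and to 1 elsewhere, which is smooth near x.  The Leibniz rule gives the value 0. *)
Lemma nabla_local0 x v Y : (\forall y \near x, Y y = 0) -> nabla x v Y = 0.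
Proof.
move=> Y0.
(* not smooth away from x in general, but constant near x *)
pose f y : R := if Y y == 0 then 0 else 1.
have sY : smooth_vf_near x Y.
  by apply: smooth_vf_near_eq (smooth_vf_near0 x); apply: filterS Y0 => y ->.
have sf : smooth_fun_near x f.
  apply: smooth_fun_near_eq (smooth_fun_near_cst x 0).
  by apply: filterS Y0 => y; rewrite /f => ->; rewrite eqxx.
have eY : Y = fun y => f y *: Y y.
  by apply/funext => y; rewrite /f; case: eqP => [->|_]; rewrite ?scaler0 ?scale1r.
have Yx := nbhs_singleton Y0.
by rewrite eY nablaZ // /f Yx eqxx scaler0 scale0r addr0.
Qed.

Lemma nabla_near_eq x v Y Z : (\forall y \near x, Y y = Z y) ->
  smooth_vf_near x Y -> nabla x v Y = nabla x v Z.
Proof.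
move=> e sY.
have e0 : \forall y \near x, Z y - Y y = 0 by apply: filterS e => y ->; rewrite subrr.
have s0 : smooth_vf_near x (fun y => Z y - Y y).
  by apply: smooth_vf_near_eq (smooth_vf_near0 x); apply: filterS e0 => y ->.
have -> : Z = fun y => Y y + (Z y - Y y) by apply/funext => y; rewrite addrC subrK.
by rewrite nablaD // (nabla_local0 _ e0) addr0.
Qed.

Lemma nabla_sum x v (I : Type) (r : seq I) (X : I -> vfield M) :
  (forall i, smooth_vf_near x (X i)) ->
  nabla x v (fun y => \sum_(i <- r) X i y) = \sum_(i <- r) nabla x v (X i).
Proof.
move=> sX; elim: r => [|i r IH].
  by rewrite big_nil; apply: nabla_local0; apply: nearW => y; rewrite big_nil.
rewrite big_cons -IH -nablaD //; last exact: smooth_vf_near_sum.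
by congr nabla; apply/funext => y; rewrite big_cons.
Qed.

Lemma nabla0v x Y : smooth_vf_near x Y -> nabla x 0 Y = 0.
Proof.
move=> sY; have := nabla_linv (-1) 0 0 sY.
by rewrite scaler0 addr0 scaleN1r addNr.
Qed.

Lemma nabla_sumv x Y (I : Type) (r : seq I) (a : I -> R) (u : I -> 'rV[R]_m) :
  smooth_vf_near x Y ->
  nabla x (\sum_(i <- r) a i *: u i) Y = \sum_(i <- r) a i *: nabla x (u i) Y.
Proof.
move=> sY; elim: r => [|i r IH]; first by rewrite !big_nil nabla0v.
by rewrite !big_cons nabla_linv // IH.
Qed.

Lemma smooth_cov x X Y : smooth_vf_near x X -> smooth_vf_near x Y ->
  smooth_vf_near x (cov nabla X Y).
Proof.
have [_ _ _ cs] := nablaC.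
move=> [U [oU Ux] sX] [U' [oU' U'x] sY]; exists (U `&` U'); first by split; [exact: openI|].
apply: cs; first exact: openI.
  by apply: smooth_vf_sub sX => y [].
by apply: smooth_vf_sub sY => y [].
Qed.

(** The form in which the Leibniz rule is used: a field given near x by its
    components in a frame. *)
Lemma nabla_near_sumZ x v (I : Type) (r : seq I) (c : I -> M -> R) (u : I -> vfield M) Y :
  (forall i, smooth_fun_near x (c i)) -> (forall i, smooth_vf_near x (u i)) ->
  (\forall y \near x, Y y = \sum_(i <- r) c i y *: u i y) ->
  nabla x v Y = \sum_(i <- r) (dirder x v (c i) *: u i x + c i x *: nabla x v (u i)).
Proof.
move=> sc su e; have scu i : smooth_vf_near x (fun y => c i y *: u i y).
  exact: smooth_vf_nearZ.
rewrite -(@nabla_near_eq x v (fun y => \sum_(i <- r) c i y *: u i y) Y).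
- by rewrite nabla_sum //; apply: eq_bigr => i _; rewrite nablaZ.
- by apply: filterS e => y ->.
- exact: smooth_vf_near_sum.
Qed.

End Connection.

(** * Splittings of the tangent bundle *)

Section Splitting.
Variables (R : realType) (m : nat) (M : manifold R m).
Implicit Types (D : plane_field M) (g : tensor2 M) (x : M).

(** A metric with its Levi-Civita connection and orthonormal frames of two
    complementary orthogonal distributions over U.  The roles of D1 and D2 can be
    exchanged ([splitting_swap]), so statements about the forms of D1 apply to
    those of D2. *)
Record splitting g (nabla : connection M) (U : set M) D1 D2 (k1 k2 : nat)
    (e : 'I_k1 -> vfield M) (f : 'I_k2 -> vfield M) : Prop := Splitting {
  split_sym : symmetric_tensor setT g;
  split_pos : forall x u, u != 0 -> 0 < g x u u;
  split_smooth : forall V X Y, open V -> smooth_vf V X -> smooth_vf V Y ->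
    smooth_fun V (on_fields g X Y);
  split_LC : levi_civita g nabla;
  split_dir : direct_decomposition D1 D2;
  split_adapted : adapted D1 D2 g;
  split_open : open U;
  split_dim1 : forall x, \dim (D1 x) = k1;
  split_dim2 : forall x, \dim (D2 x) = k2;
  split_frame1 : orthonormal_frame g D1 U e;
  split_frame2 : orthonormal_frame g D2 U f }.

Lemma splitting_swap g nabla U D1 D2 k1 k2 e f :
  @splitting g nabla U D1 D2 k1 k2 e f -> splitting g nabla U D2 D1 f e.
Proof.
case=> sym pos sm LC dir ad oU d1 d2 f1 f2; split=> //.
  by move=> x; have [+ +] := dir x; rewrite addvC capvC.
by move=> x u v; rewrite (tensorC sym I) ad.
Qed.

Lemma component_in D1 D2 x v : component D1 D2 x v \in D1 x.
Proof. exact: memv_pi. Qed.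

Section Direct.
Variables D1 D2 : plane_field M.
Hypothesis dir : direct_decomposition D1 D2.

Lemma component_id x v : v \in D1 x -> component D1 D2 x v = v.
Proof. by have [_ c0] := dir x; apply: daddv_pi_id. Qed.

Lemma component_add x v : component D1 D2 x v + component D2 D1 x v = v.
Proof.
have [s c0] := dir x; apply: daddv_pi_add => //.
by rewrite s memvf.
Qed.

(** The projections add up to the identity and the one onto D2 fixes v. *)
Lemma component_other x v : v \in D2 x -> component D1 D2 x v = 0.
Proof.
have [_ c0] := dir x; move=> vD.
have e2 : component D2 D1 x v = v by apply: daddv_pi_id => //; rewrite capvC.
apply: (@addIr _ v); rewrite add0r -[RHS](component_add x v).
by congr (_ + _); rewrite e2.
Qed.
End Direct.

Section Geometry.
Variables (g : tensor2 M) (nabla : connection M) (U : set M) (D1 D2 : plane_field M).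
Variables (k1 k2 : nat) (e : 'I_k1 -> vfield M) (f : 'I_k2 -> vfield M).
Hypothesis H : splitting g nabla U D1 D2 e f.
Let dir := split_dir H.
Let sg := split_sym H.

Lemma LC_connection : is_connection nabla. Proof. by have [] := split_LC H. Qed.

Lemma frame_in x a : U x -> e a x \in D1 x.
Proof. by move=> Ux; have [_ /(_ x Ux)[+ _]] := split_frame1 H; apply. Qed.

Lemma frame_orthonormal x a b : U x -> g x (e a x) (e b x) = (a == b)%:R.
Proof. by move=> Ux; have [_ /(_ x Ux)[_ +]] := split_frame1 H; apply. Qed.

Lemma frame_smooth x a : U x -> smooth_vf_near x (e a).
Proof.
move=> Ux; have [+ _] := split_frame1 H => /(_ a); apply: smooth_vf_nearP => //.
exact: split_open H.
Qed.

Lemma near_domain x (P : M -> Prop) : U x -> (forall y, U y -> P y) -> \forall y \near x, P y.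
Proof.
move=> Ux UP; exact: filterS UP (open_nbhs_nbhs (conj (split_open H) Ux)).
Qed.

Lemma orth12 x u v : u \in D1 x -> v \in D2 x -> g x u v = 0.
Proof.
move=> uD vD; have dir' : direct_decomposition D2 D1.
  by move=> y; have [+ +] := dir y; rewrite addvC capvC.
by rewrite -(component_id dir uD) -(component_id dir' vD) (split_adapted H).
Qed.

(** Orthonormal vectors are free, and there are dim D1 of them. *)
Lemma frame_expand x v : U x -> v \in D1 x -> v = \sum_a g x v (e a x) *: e a x.
Proof.
move=> Ux vD.
pose t := [tuple e a x | a < k1].
have tn (a : 'I_k1) : t`_a = e a x by rewrite -tnth_nth tnth_mktuple.
have bt : basis_of (D1 x) t.
  rewrite basisEfree size_tuple (split_dim1 H) leqnn andbT; apply/andP; split.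
    apply/freeP => k k0 b.
    have : g x (\sum_(i < k1) k i *: t`_i) (e b x) = 0 by rewrite k0 (tensor0l sg I).
    rewrite (tensor_suml sg I) (bigD1 b) //= tn (tensorZl sg I) frame_orthonormal // eqxx mulr1.
    rewrite big1 ?addr0 // => a ab; rewrite tn (tensorZl sg I) frame_orthonormal //.
    by rewrite (negbTE ab) mulr0.
  by apply/span_subvP => w /mapP[a _ ->]; apply: frame_in.
have := coord_basis bt vD => ev.
have {}ev : v = \sum_a coord t a v *: e a x.
  by rewrite [LHS]ev; apply: eq_bigr => a _; rewrite tn.
rewrite [LHS]ev; apply: eq_bigr => a _; congr (_ *: _).
rewrite [in RHS]ev (tensor_suml sg I) (bigD1 a) //= (tensorZl sg I) frame_orthonormal // eqxx mulr1.
rewrite big1 ?addr0 // => b ba; rewrite (tensorZl sg I) frame_orthonormal //.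
by rewrite (negbTE ba) mulr0.
Qed.

End Geometry.
End Splitting.

(** * Second fundamental form, integrability tensor and divergence in a frame *)

Section Component.
Variables (R : realType) (m : nat) (M : manifold R m).
Variables (g : tensor2 M) (nabla : connection M) (U : set M) (D1 D2 : plane_field M).
Variables (k1 k2 : nat) (e : 'I_k1 -> vfield M) (f : 'I_k2 -> vfield M).
Hypothesis H : splitting g nabla U D1 D2 e f.
Implicit Types (X Y Z : vfield M) (x y : M) (B : field_op2 M).
Let dir := split_dir H.
Let sg := split_sym H.
Let H' := splitting_swap H.
Let dir' := split_dir H'.
Let nablaC := LC_connection H.

Lemma orth21 x u v : u \in D2 x -> v \in D1 x -> g x u v = 0.
Proof. exact: (orth12 H'). Qed.

Lemma metric_component x v w : w \in D1 x -> g x (component D1 D2 x v) w = g x v w.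
Proof.
move=> wD; rewrite -[in RHS](component_add dir x v) (tensorDl sg I).
by rewrite (orth21 (component_in _ _ _ _) wD) addr0.
Qed.

Lemma componentE x v : U x ->
  component D1 D2 x v = \sum_a g x v (e a x) *: e a x.
Proof.
move=> Ux; rewrite [LHS](frame_expand H Ux (component_in _ _ _ _)).
by apply: eq_bigr => a _; rewrite metric_component // (frame_in H).
Qed.

Lemma smooth_pairing x X Y : smooth_vf_near x X -> smooth_vf_near x Y ->
  smooth_fun_near x (on_fields g X Y).
Proof.
move=> [V [oV Vx] sX] [V' [oV' V'x] sY]; exists (V `&` V'); first by split; [exact: openI|].
apply: (split_smooth H); first exact: openI.
  by apply: smooth_vf_sub sX => y [].
by apply: smooth_vf_sub sY => y [].
Qed.

Lemma near_component x X : U x ->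
  \forall y \near x, \sum_a on_fields g X (e a) y *: e a y = component_vf D1 D2 X y.
Proof.
by move=> Ux; apply: (near_domain H Ux) => y Uy; rewrite /component_vf componentE.
Qed.

Lemma smooth_component x X : U x -> smooth_vf_near x X ->
  smooth_vf_near x (component_vf D1 D2 X).
Proof.
move=> Ux sX; apply: smooth_vf_near_eq (near_component X Ux) _.
apply: smooth_vf_near_sum => a; apply: smooth_vf_nearZ; last exact: (frame_smooth H).
by apply: smooth_pairing => //; apply: (frame_smooth H).
Qed.

End Component.

Section Geometry.
Variables (R : realType) (m : nat) (M : manifold R m).
Variables (g : tensor2 M) (nabla : connection M) (U : set M) (D1 D2 : plane_field M).
Variables (k1 k2 : nat) (e : 'I_k1 -> vfield M) (f : 'I_k2 -> vfield M).
Hypothesis H : splitting g nabla U D1 D2 e f.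
Implicit Types (X Y Z : vfield M) (x y : M) (B : field_op2 M).
Let sg := split_sym H.
Let H' := splitting_swap H.
Let nablaC := LC_connection H.

(** The derivatives of the components of Y multiply sections of D1, which are
    orthogonal to n.  Hence nabla_v Y has a component normal to D1 that is
    bilinear in v and Y(x), in any frame, orthonormal or not. *)
Lemma normal_part x (K J : finType) (c : K -> R) (u : K -> vfield M)
    (d : J -> M -> R) (w : J -> vfield M) (v n : 'rV[R]_m) Y :
  v = \sum_i c i *: u i x ->
  (forall j, smooth_fun_near x (d j)) -> (forall j, smooth_vf_near x (w j)) ->
  (forall j, w j x \in D1 x) ->
  (\forall y \near x, Y y = \sum_j d j y *: w j y) -> n \in D2 x ->
  g x (nabla x v Y) n = \sum_i \sum_j c i * d j x * g x (nabla x (u i x) (w j)) n.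
Proof.
move=> -> sd sw wD eY nD; rewrite exchange_big /=.
rewrite (nabla_near_sumZ nablaC _ sd sw eY) (tensor_suml sg I); apply: eq_bigr => j _.
rewrite (tensorDl sg I) (tensorZl sg I) (orth12 H (wD j) nD) mulr0 add0r.
rewrite (nabla_sumv nablaC) // (tensorZl sg I) (tensor_suml sg I) mulr_sumr.
by apply: eq_bigr => i _; rewrite (tensorZl sg I) mulrCA mulrA.
Qed.

(** Coefficients of the bilinear map (X, Y) |-> (nabla_X Y)^perp on D1; h and T
    are its symmetric and skew parts. *)
Definition normal_coef x i a b := g x (nabla x (e a x) (e b)) (f i x).
Definition sym_coef x i a b := 2^-1 * (normal_coef x i a b + normal_coef x i b a).
Definition skew_coef x i a b := 2^-1 * (normal_coef x i a b - normal_coef x i b a).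

Lemma sym_coefC x i a b : sym_coef x i a b = sym_coef x i b a.
Proof. by rewrite /sym_coef addrC. Qed.

Lemma skew_coefC x i a b : skew_coef x i a b = - skew_coef x i b a.
Proof. by rewrite /skew_coef -mulrN opprB. Qed.

Lemma normal_coefE x i a b : normal_coef x i a b = sym_coef x i a b + skew_coef x i a b.
Proof. rewrite /sym_coef /skew_coef; lra. Qed.

Lemma smooth_normal_coef x i a b : U x -> smooth_fun_near x (fun y => normal_coef y i a b).
Proof.
move=> Ux; apply: (smooth_pairing H); last exact: (frame_smooth H').
by apply: (smooth_cov nablaC); apply: (frame_smooth H).
Qed.

Lemma smooth_sym_coef x i a b : U x -> smooth_fun_near x (fun y => sym_coef y i a b).
Proof.
move=> Ux; apply: smooth_fun_nearM; first exact: smooth_fun_near_cst.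
by apply: smooth_fun_nearD; apply: smooth_normal_coef.
Qed.

Lemma smooth_skew_coef x i a b : U x -> smooth_fun_near x (fun y => skew_coef y i a b).
Proof.
move=> Ux; apply: smooth_fun_nearM; first exact: smooth_fun_near_cst.
apply: smooth_fun_nearD; first exact: smooth_normal_coef.
apply: (@smooth_fun_near_eq _ _ _ x (fun y => (-1) * normal_coef y i b a)).
  by apply: nearW => y; rewrite mulN1r.
by apply: smooth_fun_nearM; [exact: smooth_fun_near_cst|exact: smooth_normal_coef].
Qed.

Lemma cov_component x X Y i : U x -> smooth_vf_near x X -> smooth_vf_near x Y ->
  g x (cov nabla (component_vf D1 D2 X) (component_vf D1 D2 Y) x) (f i x) =
  \sum_a \sum_b g x (X x) (e a x) * g x (Y x) (e b x) * normal_coef x i a b.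
Proof.
move=> Ux sX sY.
apply: (normal_part (d := fun b => on_fields g Y (e b))).
- by rewrite /component_vf (componentE H).
- by move=> b; apply: (smooth_pairing H) => //; apply: (frame_smooth H).
- by move=> b; apply: (frame_smooth H).
- by move=> b; apply: (frame_in H).
- by apply: filterS (near_component H Y Ux) => y ->.
- exact: (frame_in H').
Qed.

(** B is bilinear over functions, depends only on the D1 components of its
    arguments, and has coefficients b in the frames; h and T are of this kind. *)
Definition frame_op B (b : M -> 'I_k2 -> 'I_k1 -> 'I_k1 -> R) : Prop :=
  forall x X Y, U x -> smooth_vf_near x X -> smooth_vf_near x Y ->
  B X Y x = \sum_i (\sum_a \sum_c g x (X x) (e a x) * g x (Y x) (e c x) * b x i a c) *: f i x.

Lemma bracket_cov x X Y : smooth_vf_near x X -> smooth_vf_near x Y ->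
  bracket X Y x = cov nabla X Y x - cov nabla Y X x.
Proof. by move=> sX sY; have [_ + _] := split_LC H => ->. Qed.

Lemma second_formE : frame_op (second_form nabla D1 D2) sym_coef.
Proof.
move=> x X Y Ux sX sY.
have sX1 := smooth_component H Ux sX; have sY1 := smooth_component H Ux sY.
rewrite /second_form /component_vf (componentE H' _ Ux); apply: eq_bigr => i _.
congr (_ *: _); rewrite (tensorZl sg I) (tensorDl sg I) !cov_component //.
rewrite [X in _ * (_ + X)]exchange_big -big_split /= mulr_sumr; apply: eq_bigr => a _.
rewrite -big_split /= mulr_sumr; apply: eq_bigr => c _.
by rewrite /sym_coef [g x (Y x) _ * _]mulrC -mulrDr mulrCA.
Qed.

Lemma integrabilityE : frame_op (integrability D1 D2) skew_coef.
Proof.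
move=> x X Y Ux sX sY.
have sX1 := smooth_component H Ux sX; have sY1 := smooth_component H Ux sY.
rewrite /integrability /component_vf (componentE H' _ Ux); apply: eq_bigr => i _.
congr (_ *: _); rewrite -!/(component_vf _ _ _) bracket_cov //.
rewrite (tensorZl sg I) (tensorBl sg I) !cov_component //.
rewrite [X in _ * (_ - X)]exchange_big -sumrB /= mulr_sumr; apply: eq_bigr => a _.
rewrite -sumrB /= mulr_sumr; apply: eq_bigr => c _.
by rewrite /skew_coef [g x (Y x) _ * _]mulrC -mulrBr mulrCA.
Qed.

Lemma sum_delta (k : nat) (V : lmodType R) (a : 'I_k) (F : 'I_k -> V) :
  \sum_c (a == c)%:R *: F c = F a.
Proof.
rewrite (bigD1 a) //= eqxx scale1r big1 ?addr0 // => c ca.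
by rewrite eq_sym (negbTE ca) scale0r.
Qed.

Lemma sum_deltaM (k : nat) (a : 'I_k) (F : 'I_k -> R) : \sum_c (a == c)%:R * F c = F a.
Proof. exact: (sum_delta (V := R^o)). Qed.

Lemma frame_opE B b x a c : frame_op B b -> U x ->
  B (e a) (e c) x = \sum_i b x i a c *: f i x.
Proof.
move=> Bb Ux; rewrite Bb //; [|exact: (frame_smooth H)|exact: (frame_smooth H)].
apply: eq_bigr => i _; congr (_ *: _).
rewrite -[RHS](sum_deltaM a (fun a => b x i a c)); apply: eq_bigr => a' _.
rewrite (frame_orthonormal H) // -[b x i a' c](sum_deltaM c (fun c => b x i a' c)) mulr_sumr.
by apply: eq_bigr => c' _; rewrite (frame_orthonormal H) // mulrA.
Qed.

Lemma frame_op_pair B b x X i c : frame_op B b -> U x -> smooth_vf_near x X ->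
  g x (B X (e c) x) (f i x) = \sum_a g x (X x) (e a x) * b x i a c.
Proof.
move=> Bb Ux sX; rewrite Bb //; last exact: (frame_smooth H).
rewrite (tensor_suml sg I) (bigD1 i) //= (tensorZl sg I) (frame_orthonormal H') // eqxx mulr1.
rewrite [X in _ + X]big1 ?addr0 => [|j ji]; last first.
  by rewrite (tensorZl sg I) (frame_orthonormal H') // (negbTE ji) mulr0.
apply: eq_bigr => a _; rewrite -[in RHS](sum_deltaM c (fun c => b x i a c)) mulr_sumr.
by apply: eq_bigr => c' _; rewrite (frame_orthonormal H) // mulrA.
Qed.

(** The vector on the right has the required products with the sections of D1, and
    testing on the frame fields shows that it is the only one in D1. *)
Lemma adjoint_opE B b x X i : frame_op B b -> U x -> smooth_vf_near x X ->
  adjoint_op g D1 B (f i) X x =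
  \sum_c (\sum_a g x (X x) (e a x) * b x i a c) *: e c x.
Proof.
move=> Bb Ux sX; apply: xget_unique => [|w [wD wP]].
  split=> [|Y sY YD].
    by apply: memv_suml => c _; apply: memvZ; apply: (frame_in H).
  rewrite (tensor_suml sg I) Bb //.
  rewrite (tensor_suml sg I) (bigD1 i) //= (tensorZl sg I) (frame_orthonormal H') // eqxx mulr1.
  rewrite [X in _ = _ + X]big1 ?addr0 => [|j ji]; last first.
    by rewrite (tensorZl sg I) (frame_orthonormal H') // (negbTE ji) mulr0.
  rewrite exchange_big; apply: eq_bigr => c _ /=.
  rewrite (tensorZl sg I) mulr_suml; apply: eq_bigr => a _.
  by rewrite (tensorC sg I (e c x)) mulrAC.
rewrite (frame_expand H Ux wD); apply: eq_bigr => c _; congr (_ *: _).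
rewrite -(@frame_op_pair B b x X i c) //; apply: wP; first exact: (frame_smooth H).
by apply: (near_domain H Ux) => y Uy; apply: (frame_in H).
Qed.

(** The outer operator needs a field smooth near x as its argument; the inner value
    is one because its coefficients in the frame are. *)
Lemma adjoint_op2E B b B' b' x a i :
  frame_op B b -> frame_op B' b' -> U x ->
  (forall a c, smooth_fun_near x (fun y => b' y i a c)) ->
  adjoint_op g D1 B (f i) (adjoint_op g D1 B' (f i) (e a)) x =
  \sum_c (\sum_d b' x i a d * b x i d c) *: e c x.
Proof.
move=> Bb Bb' Ux sb'.
have adE y : U y -> \sum_d b' y i a d *: e d y = adjoint_op g D1 B' (f i) (e a) y.
  move=> Uy; rewrite (adjoint_opE _ Bb') //; last exact: (frame_smooth H).
  apply: eq_bigr => c _; congr (_ *: _).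
  rewrite -[LHS](sum_deltaM a (fun a => b' y i a c)); apply: eq_bigr => a' _.
  by rewrite (frame_orthonormal H).
rewrite (adjoint_opE _ Bb) //; last first.
  apply: smooth_vf_near_eq (near_domain H Ux adE) _.
  apply: smooth_vf_near_sum => d; apply: smooth_vf_nearZ => //; exact: (frame_smooth H).
apply: eq_bigr => c _; congr (_ *: _); apply: eq_bigr => d _; congr (_ * _).
rewrite -adE // (tensor_suml sg I) (bigD1 d) //= (tensorZl sg I) (frame_orthonormal H) // eqxx mulr1.
rewrite big1 ?addr0 // => j ji.
by rewrite (tensorZl sg I) (frame_orthonormal H) // (negbTE ji) mulr0.
Qed.

Lemma pair_frame_sum x (c : 'I_k1 -> R) a : U x ->
  g x (\sum_d c d *: e d x) (e a x) = c a.
Proof.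
move=> Ux; rewrite (tensor_suml sg I) (bigD1 a) //= (tensorZl sg I) (frame_orthonormal H) // eqxx mulr1.
rewrite big1 ?addr0 // => j ji.
by rewrite (tensorZl sg I) (frame_orthonormal H) // (negbTE ji) mulr0.
Qed.

Lemma frame_expand12 x v : U x ->
  v = \sum_a g x v (e a x) *: e a x + \sum_i g x v (f i x) *: f i x.
Proof.
move=> Ux; rewrite -[LHS](component_add (split_dir H) x v).
by rewrite (componentE H _ Ux) (componentE H' _ Ux).
Qed.

(** The divergence is a trace in the standard basis of the chart; expanding the
    basis vectors in the orthonormal frame turns it into the trace there. *)
Lemma divergenceE x X : U x -> smooth_vf_near x X -> divergence nabla X x =
  \sum_a g x (nabla x (e a x) X) (e a x) + \sum_i g x (nabla x (f i x) X) (f i x).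
Proof.
move=> Ux sX; rewrite /divergence /mxtrace.
pose Q (v : 'rV[R]_m) j := (nabla x v X) 0 j.
transitivity (\sum_j (\sum_a g x (delta_mx 0 j) (e a x) * Q (e a x) j
   + \sum_i g x (delta_mx 0 j) (f i x) * Q (f i x) j)).
  apply: eq_bigr => j _; rewrite mxE {1}(frame_expand12 (delta_mx 0 j) Ux) /=.
  rewrite -[X in nabla x (X + _)]scale1r (nabla_linv nablaC) // !(nabla_sumv nablaC) //.
  rewrite scale1r mxE !summxE; congr (_ + _); apply: eq_bigr => i _; by rewrite mxE.
have tr v : \sum_j g x (delta_mx 0 j) v * Q v j = g x (nabla x v X) v.
  rewrite [X in g x X _]row_sum_delta (tensor_suml sg I); apply: eq_bigr => j _.
  by rewrite (tensorZl sg I) mulrC.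
rewrite big_split /=; congr (_ + _); rewrite exchange_big; exact: eq_bigr.
Qed.

Lemma divergenceZ x p X : U x -> smooth_fun_near x p -> smooth_vf_near x X ->
  divergence nabla (fun y => p y *: X y) x = dirder x (X x) p + p x * divergence nabla X x.
Proof.
move=> Ux sp sX; rewrite !divergenceE //; last exact: smooth_vf_nearZ.
have -> : dirder x (X x) p = \sum_a g x (X x) (e a x) * dirder x (e a x) p
   + \sum_i g x (X x) (f i x) * dirder x (f i x) p.
  rewrite {1}(frame_expand12 (X x) Ux) -[X in dirder x (X + _)]scale1r dirder_lin //.
  by rewrite !dirder_sumv // mul1r.
rewrite mulrDr addrACA; congr (_ + _); rewrite mulr_sumr -big_split; apply: eq_bigr => a _ /=;
  by rewrite (nablaZ nablaC) // (tensorDl sg I) !(tensorZl sg I) mulrC.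
Qed.

Lemma divergenceD x X Y : U x -> smooth_vf_near x X -> smooth_vf_near x Y ->
  divergence nabla (fun y => X y + Y y) x = divergence nabla X x + divergence nabla Y x.
Proof.
move=> Ux sX sY; rewrite !divergenceE //; last exact: smooth_vf_nearD.
rewrite addrACA; congr (_ + _); rewrite -big_split; apply: eq_bigr => a _ /=;
  by rewrite (nablaD nablaC) // (tensorDl sg I).
Qed.

Lemma divergence_near_eq x X Y : U x -> (\forall y \near x, X y = Y y) ->
  smooth_vf_near x X -> divergence nabla X x = divergence nabla Y x.
Proof.
move=> Ux e0 sX; have sY := smooth_vf_near_eq e0 sX; rewrite !divergenceE //.
by congr (_ + _); apply: eq_bigr => a _; rewrite (nabla_near_eq nablaC _ e0).
Qed.

Lemma divergence_sum x (K : Type) (r : seq K) (X : K -> vfield M) : U x ->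
  (forall i, smooth_vf_near x (X i)) ->
  divergence nabla (fun y => \sum_(i <- r) X i y) x = \sum_(i <- r) divergence nabla (X i) x.
Proof.
move=> Ux sX; elim: r => [|i r IH].
  rewrite big_nil divergenceE //; last first.
    by apply: smooth_vf_near_eq (smooth_vf_near0 x); apply: nearW => y; rewrite big_nil.
  rewrite !big1 ?addr0 // => a _; rewrite (nabla_local0 nablaC) ?(tensor0l sg I) //;
    by apply: nearW => y; rewrite big_nil.
rewrite big_cons -IH -divergenceD //; last exact: smooth_vf_near_sum.
apply: divergence_near_eq => //; first by apply: nearW => y; rewrite big_cons.
apply: smooth_vf_near_eq (smooth_vf_nearD (sX i) (smooth_vf_near_sum r sX)).
by apply: nearW => y; rewrite big_cons.
Qed.

End Geometry.

(** * The right-hand sides as traces *)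

Section MatrixAlgebra.
Variables (R : comNzRingType) (k : nat).
Implicit Types (P Q S T C G : 'M[R]_k).

Lemma mxtrace_mulE P Q : \tr (P *m Q) = \sum_a \sum_b P a b * Q b a.
Proof. by apply: eq_bigr => a _; rewrite mxE. Qed.

Lemma mxtrace_mul_tr P Q : \tr (P *m Q^T) = \sum_a \sum_b P a b * Q a b.
Proof.
by rewrite mxtrace_mulE; apply: eq_bigr => a _; apply: eq_bigr => b _; rewrite mxE.
Qed.
End MatrixAlgebra.

Section MatrixReal.
Variables (R : realType) (k : nat).
Implicit Types (P Q S T C G : 'M[R]_k).

Lemma mxtrace_skew P S : P^T = - P -> S^T = S -> \tr (P *m S) = 0.
Proof.
move=> eP eS; have : \tr (P *m S) = - \tr (P *m S).
  by rewrite -[LHS]mxtrace_tr trmx_mul eP eS mulmxN raddfN /= mxtrace_mulC.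
lra.
Qed.

(** For a fixed i, Phi, T and C are the matrices of h, of the integrability tensor
    and of the connection along f_i, G is that of the f_i S(e_a, e_b), and Br that
    of the S([e_a, f_i], e_b).  The left side is the time derivative of the term i
    of the square norm of h, the right side comes from div h, K and div <h, S>.
    For A skew, transposition and cyclicity of the trace give
    tr (A Phi S) = - tr (Phi A S). *)
Lemma variation_algebra Phi T C S G (Br := - ((Phi + T + C) *m S)) :
  Phi^T = Phi -> T^T = - T -> C^T = - C -> S^T = S ->
  2 * \tr (Phi *m (- 2^-1 *: (G + Br + Br^T))) - 2 * \tr (S *m (Phi *m Phi))
  = \tr ((Phi *m T - T *m Phi - C *m Phi - (C *m Phi)^T) *m S) - \tr (Phi *m G).
Proof.
move=> eP eT eC eS.
have skew A : A^T = - A -> \tr (A *m Phi *m S) = - \tr (Phi *m A *m S).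
  move=> eA; rewrite -[LHS]mxtrace_tr !trmx_mul eA eP eS mulmxN mulmxN raddfN /=.
  by rewrite mxtrace_mulC.
have eBr : \tr (Phi *m Br) = - (\tr (Phi *m Phi *m S) + \tr (Phi *m T *m S) + \tr (Phi *m C *m S)).
  by rewrite /Br mulmxN raddfN /= mulmxA !mulmxDr !mulmxDl !raddfD.
have eBr' : \tr (Phi *m Br^T) = \tr (Phi *m Br).
  by rewrite -[LHS]mxtrace_tr trmx_mul trmxK eP mxtrace_mulC.
have eCP : \tr ((C *m Phi)^T *m S) = \tr (C *m Phi *m S).
  by rewrite -[LHS]mxtrace_tr trmx_mul trmxK eS mxtrace_mulC.
rewrite -scalemxAr linearZ /= !mulmxDr !raddfD /= eBr' eBr.
rewrite !mulmxBl !raddfB /= eCP (skew T eT) (skew C eC).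
rewrite [\tr (S *m _)]mxtrace_mulC; lra.
Qed.
End MatrixReal.

Section Static.
Variables (R : realType) (m : nat) (M : manifold R m).
Variables (g : tensor2 M) (nabla : connection M) (U : set M) (D1 D2 : plane_field M).
Variables (k1 k2 : nat) (e : 'I_k1 -> vfield M) (f : 'I_k2 -> vfield M).
Hypothesis H : splitting g nabla U D1 D2 e f.
Implicit Types (X Y Z N : vfield M) (x y : M) (B : field_op2 M).
Let sg := split_sym H.
Let H' := splitting_swap H.
Let nablaC := LC_connection H.

Lemma metric_compat x v Y Z : smooth_vf_near x Y -> smooth_vf_near x Z ->
  dirder x v (on_fields g Y Z) = g x (nabla x v Y) (Z x) + g x (Y x) (nabla x v Z).
Proof. by have [_ _ +] := split_LC H; apply. Qed.

(** Metric compatibility applied to g(X, N) = 0 and g(Y, N) = 0 trades nabla_X Y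
    for - nabla_X N; torsion-freeness then makes nabla_N X appear, and the terms
    in nabla_N add up to N g(X, Y). *)
Lemma koszul x X Y N : smooth_vf_near x X -> smooth_vf_near x Y -> smooth_vf_near x N ->
  (\forall y \near x, g y (X y) (N y) = 0) -> (\forall y \near x, g y (Y y) (N y) = 0) ->
  g x (nabla x (X x) Y) (N x) + g x (nabla x (Y x) X) (N x) =
  - (dirder x (N x) (on_fields g X Y) + g x (bracket X N x) (Y x) + g x (bracket Y N x) (X x)).
Proof.
move=> sX sY sN XN YN.
have d1 := metric_compat (X x) sY sN; have d2 := metric_compat (Y x) sX sN.
rewrite (@dirder_near_eq _ _ _ _ _ _ (fun=> 0)) // dirder_cst in d1.
rewrite (@dirder_near_eq _ _ _ _ _ _ (fun=> 0)) // dirder_cst in d2.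
rewrite metric_compat // !(bracket_cov H) // /cov !(tensorBl sg I).
rewrite (tensorC sg I (nabla x (X x) N)) (tensorC sg I (nabla x (Y x) N)).
rewrite (tensorC sg I (nabla x (N x) Y)).
lra.
Qed.

(** The coefficients of the connection that nabla induces on D1, along f_i. *)
Definition conn_coef x i a b := g x (nabla x (f i x) (e a)) (e b x).

(** The products g(e_a, e_b) are constant. *)
Lemma conn_coefC x i a b : U x -> conn_coef x i a b = - conn_coef x i b a.
Proof.
move=> Ux.
have := metric_compat (f i x) (frame_smooth H a Ux) (frame_smooth H b Ux).
rewrite (@dirder_near_eq _ _ _ _ _ _ (fun=> (a == b)%:R)); last first.
  by apply: (near_domain H Ux) => y Uy; rewrite /on_fields (frame_orthonormal H).
rewrite dirder_cst /conn_coef (tensorC sg I (e a x)); lra.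
Qed.

(** The products g(f_i, e_b) vanish. *)
Lemma conn_mixed x i a b : U x ->
  g x (nabla x (e a x) (f i)) (e b x) = - normal_coef g nabla e f x i a b.
Proof.
move=> Ux.
have := metric_compat (e a x) (frame_smooth H' i Ux) (frame_smooth H b Ux).
rewrite (@dirder_near_eq _ _ _ _ _ _ (fun=> 0)); last first.
  by apply: (near_domain H Ux) => y Uy; rewrite /on_fields (orth12 H') // ?(frame_in H') ?(frame_in H).
rewrite dirder_cst /normal_coef (tensorC sg I (f i x)); lra.
Qed.

Section Tensor.
Variable S : tensor2 M.
Hypothesis sS : symmetric_tensor setT S.
Hypothesis S0 : forall x u v, u \in D2 x -> S x u v = 0.
Hypothesis S_smooth : forall V X Y, open V -> smooth_vf V X -> smooth_vf V Y ->
    smooth_fun V (on_fields S X Y).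

Lemma smooth_tensor_pairing x X Y : smooth_vf_near x X -> smooth_vf_near x Y ->
  smooth_fun_near x (on_fields S X Y).
Proof.
move=> [V [oV Vx] sX] [V' [oV' V'x] sY]; exists (V `&` V'); first by split; [exact: openI|].
apply: S_smooth; first exact: openI.
  by apply: smooth_vf_sub sX => y [].
by apply: smooth_vf_sub sY => y [].
Qed.

(** S sees only the D1 component of its arguments. *)
Lemma null_tensor_expand x w v : U x -> S x w v = \sum_c g x w (e c x) * S x (e c x) v.
Proof.
move=> Ux; rewrite {1}(frame_expand12 H w Ux) (tensorDl sS I).
rewrite [X in _ + X](S0) ?addr0; last first.
  by apply: memv_suml => i _; apply: memvZ; apply: (frame_in H').
by rewrite (tensor_suml sS I); apply: eq_bigr => c _; rewrite (tensorZl sS I).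
Qed.

Lemma inner2E b x : U x -> inner2 e f b (on_fields S) x =
  \sum_a \sum_c b (e a) (e c) x * S x (e a x) (e c x).
Proof.
move=> Ux; rewrite /inner2 big_sumType /= [X in _ + X]big1 ?addr0 => [|i _]; last first.
  by rewrite big1 // => l _; rewrite /on_fields S0 ?mulr0 //; apply: (frame_in H').
apply: eq_bigr => a _; rewrite big_sumType /= [X in _ + X]big1 ?addr0 => [|i _] //.
by rewrite /on_fields (tensorC sS I) S0 ?mulr0 //; apply: (frame_in H').
Qed.

Lemma trace2E y : U y -> trace2 e f S y = \sum_a S y (e a y) (e a y).
Proof.
move=> Uy; rewrite /trace2 big_sumType /= [X in _ + X]big1 ?addr0 // => i _.
by rewrite S0 //; apply: (frame_in H').
Qed.

Definition tensor_mx x := \matrix_(a, b) S x (e a x) (e b x).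
Definition dtensor_mx x i := \matrix_(a, b) dirder x (f i x) (on_fields S (e a) (e b)).
Definition sym_mx x i := \matrix_(a, b) sym_coef g nabla e f x i a b.
Definition skew_mx x i := \matrix_(a, b) skew_coef g nabla e f x i a b.
Definition conn_mx x i := \matrix_(a, b) conn_coef x i a b.

Lemma tensor_mxT x : (tensor_mx x)^T = tensor_mx x.
Proof. by apply/matrixP => a b; rewrite !mxE (tensorC sS I). Qed.

Lemma sym_mxT x i : (sym_mx x i)^T = sym_mx x i.
Proof. by apply/matrixP => a b; rewrite !mxE sym_coefC. Qed.

Lemma skew_mxT x i : (skew_mx x i)^T = - skew_mx x i.
Proof. by apply/matrixP => a b; rewrite !mxE skew_coefC. Qed.

Lemma conn_mxT x i : U x -> (conn_mx x i)^T = - conn_mx x i.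
Proof. by move=> Ux; apply/matrixP => a b; rewrite !mxE conn_coefC. Qed.

(** [e_a, f_i] = nabla_a f_i - nabla_i e_a, whose D1 components are minus the
    coefficients of [normal_coef] and of [conn_coef]. *)
Lemma bracket_tensor x i : U x ->
  \matrix_(a, b) S x (bracket (e a) (f i) x) (e b x)
  = - ((sym_mx x i + skew_mx x i + conn_mx x i) *m tensor_mx x).
Proof.
move=> Ux; apply/matrixP => a b; rewrite !mxE null_tensor_expand // -sumrN; apply: eq_bigr => c _.
rewrite !mxE -normal_coefE -mulNr; congr (_ * _).
rewrite (bracket_cov H); [|exact: (frame_smooth H)|exact: (frame_smooth H')].
by rewrite /cov (tensorBl sg I) conn_mixed // opprD.
Qed.

Lemma smooth_frame_op B b x a c : frame_op g U e f B b -> U x ->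
  (forall i, smooth_fun_near x (fun y => b y i a c)) -> smooth_vf_near x (B (e a) (e c)).
Proof.
move=> Bb Ux sb; apply: (@smooth_vf_near_eq _ _ _ x (fun y => \sum_i b y i a c *: f i y)).
  by apply: (near_domain H Ux) => y Uy; rewrite (frame_opE H _ _ Bb).
by apply: smooth_vf_near_sum => i; apply: smooth_vf_nearZ => //; exact: (frame_smooth H').
Qed.

Let h := second_form nabla D1 D2.
Let T := integrability D1 D2.
Let hE := second_formE H.
Let TE := integrabilityE H.

Lemma smooth_h x a c : U x -> smooth_vf_near x (h (e a) (e c)).
Proof.
by move=> Ux; apply: (smooth_frame_op hE Ux) => i; apply: (smooth_sym_coef H).
Qed.

(** Only the connection along D2 contributes to the correction terms, because h is
    D2-valued and thus orthogonal to the e_a. *)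
Lemma div_op2E x a c : U x ->
  div_op2 e f g nabla h (e a) (e c) x = divergence nabla (h (e a) (e c)) x
   - \sum_i (conn_mx x i *m sym_mx x i + (conn_mx x i *m sym_mx x i)^T) a c.
Proof.
move=> Ux; have sh := smooth_h a c Ux.
rewrite (divergenceE H) // /div_op2 big_sumType /= -addrA; congr (_ + _).
  apply: eq_bigr => d _; rewrite /cov_op2 !(tensorBl sg I) /cov.
  have sde b : smooth_vf_near x (cov nabla (e d) (e b)).
    by apply: (smooth_cov nablaC); apply: (frame_smooth H).
  have hD2 X Y : h X Y x \in D2 x by exact: component_in.
  by rewrite !(orth12 H' (hD2 _ _)) ?(frame_in H) // !subr0.
rewrite -sumrB; apply: eq_bigr => i _; rewrite /cov_op2 !(tensorBl sg I).
have sde b : smooth_vf_near x (cov nabla (f i) (e b)).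
  by apply: (smooth_cov nablaC); [apply: (frame_smooth H')|apply: (frame_smooth H)].
have hC X Y : h X Y = h Y X.
  apply/funext => y; rewrite /h /second_form /component_vf; congr (component _ _ _ (_ *: _)).
  by rewrite addrC.
rewrite (hC (e a) (cov _ _ _)) !(frame_op_pair H _ _ hE) // !mxE -addrA -opprD; congr (_ - (_ + _)).
  by apply: eq_bigr => d _; rewrite !mxE.
by apply: eq_bigr => d _; rewrite !mxE.
Qed.

Lemma sum_commE x a c : U x ->
  flat g (sum_comm f (adjoint_op g D1 T) (adjoint_op g D1 h)) (e a) (e c) x
  = \sum_i (sym_mx x i *m skew_mx x i - skew_mx x i *m sym_mx x i) a c.
Proof.
move=> Ux; rewrite /flat /on_fields /sum_comm (tensor_suml sg I); apply: eq_bigr => i _.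
rewrite (tensorBl sg I) (adjoint_op2E H _ TE hE) //; last first.
  by move=> *; apply: (smooth_sym_coef H).
rewrite (adjoint_op2E H _ hE TE) //; last first.
  by move=> *; apply: (smooth_skew_coef H).
rewrite !(pair_frame_sum H) // !mxE; congr (_ - _); apply: eq_bigr => d _; by rewrite !mxE.
Qed.

Lemma sum_sqE x a c : U x ->
  flat g (sum_sq f (adjoint_op g D1 T)) (e a) (e c) x
  = \sum_i (skew_mx x i *m skew_mx x i) a c.
Proof.
move=> Ux; rewrite /flat /on_fields /sum_sq (tensor_suml sg I); apply: eq_bigr => i _.
rewrite (adjoint_op2E H _ TE TE) //; last by move=> *; apply: (smooth_skew_coef H).
by rewrite !(pair_frame_sum H) // !mxE; apply: eq_bigr => d _; rewrite !mxE.
Qed.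

Lemma dirder_h x a b p : U x -> smooth_fun_near x p ->
  dirder x (h (e a) (e b) x) p = \sum_i sym_coef g nabla e f x i a b * dirder x (f i x) p.
Proof. by move=> Ux sp; rewrite /h (frame_opE H _ _ hE) // dirder_sumv. Qed.

Lemma divergence_contraction x : U x ->
  divergence nabla (tensor_contraction e h S) x =
  \sum_a \sum_b S x (e a x) (e b x) * divergence nabla (h (e a) (e b)) x
  + \sum_i \tr (sym_mx x i *m dtensor_mx x i).
Proof.
move=> Ux; rewrite /tensor_contraction.
have sS' a b : smooth_fun_near x (on_fields S (e a) (e b)).
  by apply: smooth_tensor_pairing; apply: (frame_smooth H).
have st a b : smooth_vf_near x (fun y => S y (e a y) (e b y) *: h (e a) (e b) y).
  by apply: smooth_vf_nearZ; [exact: sS'|exact: smooth_h].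
rewrite (divergence_sum H) //; last by move=> a; apply: smooth_vf_near_sum.
have -> : \sum_i \tr (sym_mx x i *m dtensor_mx x i) =
    \sum_a \sum_b dirder x (h (e a) (e b) x) (on_fields S (e a) (e b)).
  under eq_bigr do rewrite mxtrace_mulE.
  rewrite exchange_big; apply: eq_bigr => a _ /=; rewrite exchange_big; apply: eq_bigr => b _ /=.
  rewrite dirder_h //; apply: eq_bigr => i _; rewrite !mxE; congr (_ * _).
  by apply: dirder_near_eq; apply: nearW => y; rewrite /on_fields (tensorC sS I).
rewrite -big_split; apply: eq_bigr => a _ /=.
rewrite (divergence_sum H) // -big_split; apply: eq_bigr => b _ /=.
rewrite (divergenceZ H) //; [|exact: sS'|exact: smooth_h].
by rewrite addrC.
Qed.

(** The terms S(e_a, e_b) div h(e_a, e_b) cancel between div h and div <h, S>. *)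
Lemma static_h x : U x ->
  inner2 e f (fun X Y y => div_op2 e f g nabla h X Y y
     + flat g (sum_comm f (adjoint_op g D1 T) (adjoint_op g D1 h)) X Y y) (on_fields S) x
  - divergence nabla (tensor_contraction e h S) x
  = \sum_i (\tr ((sym_mx x i *m skew_mx x i - skew_mx x i *m sym_mx x i
       - conn_mx x i *m sym_mx x i - (conn_mx x i *m sym_mx x i)^T) *m tensor_mx x)
       - \tr (sym_mx x i *m dtensor_mx x i)).
Proof.
move=> Ux; rewrite inner2E // divergence_contraction // sumrB opprD addrA; congr (_ - _).
rewrite -sumrB.
under [RHS]eq_bigr do rewrite mxtrace_mulE.
rewrite [RHS]exchange_big; apply: eq_bigr => a _ /=.
rewrite -sumrB [RHS]exchange_big; apply: eq_bigr => b _ /=.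
rewrite div_op2E // sum_commE // -sumrN -addrA -big_split /= -mulr_suml.
rewrite [tensor_mx x b a]mxE (tensorC sS I (e b x)) mulrDl [S x _ _ * _]mulrC addrAC subrr add0r.
congr (_ * _); apply: eq_bigr => i _.
rewrite !mxE; ring.
Qed.

Lemma trace_hE x : U x -> trace_vf e h x = \sum_i \tr (sym_mx x i) *: f i x.
Proof.
move=> Ux; rewrite /trace_vf /h; under eq_bigr do rewrite (frame_opE H _ _ hE) //.
rewrite exchange_big; apply: eq_bigr => i _; rewrite /mxtrace scaler_suml /=.
by apply: eq_bigr => a _; rewrite !mxE.
Qed.

Lemma smooth_trace_h x : U x -> smooth_vf_near x (trace_vf e h).
Proof. by move=> Ux; apply: smooth_vf_near_sum => a; apply: smooth_h. Qed.

Lemma dirder_H x p : U x -> smooth_fun_near x p ->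
  dirder x (trace_vf e h x) p = \sum_i \tr (sym_mx x i) * dirder x (f i x) p.
Proof. by move=> Ux sp; rewrite trace_hE // dirder_sumv. Qed.

(** The terms div H tr S cancel, which leaves minus the derivative of tr S along H. *)
Lemma static_H x : U x ->
  inner2 e f (fun X Y y => divergence nabla (trace_vf e h) y * on_fields g X Y y) (on_fields S) x
  - divergence nabla (fun y => trace2 e f S y *: trace_vf e h y) x
  = - \sum_i \tr (sym_mx x i) * \tr (dtensor_mx x i).
Proof.
move=> Ux; have sS' a : smooth_fun_near x (on_fields S (e a) (e a)).
  by apply: smooth_tensor_pairing; apply: (frame_smooth H).
pose p y := \sum_a on_fields S (e a) (e a) y.
have sp : smooth_fun_near x p by exact: smooth_fun_near_sum.
rewrite -(@divergence_near_eq _ _ _ _ _ _ _ _ _ _ _ _ H x (fun y => p y *: trace_vf e h y)) //;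
  last 2 first.
- by apply: (near_domain H Ux) => y Uy; rewrite trace2E.
- by apply: smooth_vf_nearZ => //; apply: smooth_trace_h.
rewrite (divergenceZ H) //; last exact: smooth_trace_h.
rewrite dirder_H // inner2E // [in X in - (_ + X)]mulrC mulr_sumr.
rewrite opprD addrCA -[RHS]addr0; congr (_ + _).
  congr (- _); apply: eq_bigr => i _; congr (_ * _).
  by rewrite dirder_sum //; apply: eq_bigr => a _; rewrite mxE.
apply/eqP; rewrite subr_eq0; apply/eqP; apply: eq_bigr => a _.
under eq_bigr do rewrite /on_fields (frame_orthonormal H) // -mulrA.
rewrite -mulr_sumr (sum_deltaM a (fun c => S x (e a x) (e c x))) //.
Qed.

Lemma static_T x : U x ->
  inner2 e f (fun X Y y => 2 * flat g (sum_sq f (adjoint_op g D1 T)) X Y y) (on_fields S) x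
  = \sum_i 2 * \tr (tensor_mx x *m (skew_mx x i *m skew_mx x i)).
Proof.
move=> Ux; rewrite inner2E //.
under [RHS]eq_bigr do rewrite mxtrace_mulC mxtrace_mulE mulr_sumr.
rewrite [RHS]exchange_big; apply: eq_bigr => a _ /=.
under [RHS]eq_bigr do rewrite mulr_sumr.
rewrite [RHS]exchange_big; apply: eq_bigr => b _ /=.
rewrite sum_sqE // mulr_sumr mulr_suml; apply: eq_bigr => i _.
by rewrite [tensor_mx x b a]mxE (tensorC sS I) mulrA.
Qed.

End Tensor.

Lemma sqnorm_frame x (c : 'I_k2 -> R) : U x ->
  g x (\sum_i c i *: f i x) (\sum_i c i *: f i x) = \sum_i c i ^+ 2.
Proof.
move=> Ux; rewrite (tensor_suml sg I); apply: eq_bigr => i _.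
by rewrite (tensorZl sg I) (tensorC sg I) (pair_frame_sum H') // expr2.
Qed.

Lemma sqnorm2E B b x : frame_op g U e f B b -> U x ->
  sqnorm2 e g B x = \sum_i \sum_a \sum_c b x i a c ^+ 2.
Proof.
move=> Bb Ux; rewrite [RHS]exchange_big; apply: eq_bigr => a _ /=.
rewrite [RHS]exchange_big; apply: eq_bigr => c _ /=.
by rewrite /sqnorm /on_fields (frame_opE H _ _ Bb) // sqnorm_frame.
Qed.

Lemma sqnorm_traceE B b x : frame_op g U e f B b -> U x ->
  sqnorm g (trace_vf e B) x = \sum_i (\sum_a b x i a a) ^+ 2.
Proof.
move=> Bb Ux; rewrite /sqnorm /on_fields.
have -> : trace_vf e B x = \sum_i (\sum_a b x i a a) *: f i x.
  rewrite /trace_vf; under eq_bigr do rewrite (frame_opE H _ _ Bb) //.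
  by rewrite exchange_big; apply: eq_bigr => i _; rewrite scaler_suml.
exact: sqnorm_frame.
Qed.

Lemma normal_coef_change x (u : 'I_k1 -> vfield M) (A : 'I_k1 -> 'I_k1 -> M -> R) i a b :
  U x -> (forall a c, smooth_fun_near x (A a c)) -> (forall c, smooth_vf_near x (u c)) ->
  (forall c, u c x \in D1 x) ->
  (forall a, \forall y \near x, e a y = \sum_c A a c y *: u c y) ->
  normal_coef g nabla e f x i a b
  = \sum_c \sum_d A a c x * A b d x * normal_coef g nabla u f x i c d.
Proof.
move=> Ux sA su uD eu; rewrite /normal_coef.
have eux := nbhs_singleton (eu a).
exact: (normal_part H eux (sA b) su uD (eu b) (frame_in H' i Ux)).
Qed.

End Static.

(** * Derivatives in time of matrices *)

Section TimeDerivative.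
Variable R : realType.

Definition deriv_at (f : R -> R) (t df : R) : Prop :=
  is_derive (t : R^o) (1 : R^o) (f : R^o -> R^o) df.

Lemma deriv_at_near_eq (f h : R -> R) (t df : R) :
  (\forall r \near (t : R^o), f r = h r) -> deriv_at f t df -> deriv_at h t df.
Proof. exact: near_eq_is_derive. Qed.

Lemma deriv_at_eq (f : R -> R) (t df dh : R) : deriv_at f t df -> df = dh -> deriv_at f t dh.
Proof. by move=> d <-. Qed.

Lemma deriv_at_unique (f : R -> R) (t df dh : R) : deriv_at f t df -> deriv_at f t dh -> df = dh.
Proof. by move=> [_ <-] [_ <-]. Qed.

Lemma deriv_at_cst (a t : R) : deriv_at (fun=> a) t 0.
Proof. exact: is_derive_cst. Qed.

Lemma deriv_atD (f h : R -> R) (t df dh : R) :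
  deriv_at f t df -> deriv_at h t dh -> deriv_at (fun r => f r + h r) t (df + dh).
Proof. by move=> d1 d2; exact: is_deriveD. Qed.

Lemma deriv_atM (f h : R -> R) (t df dh : R) :
  deriv_at f t df -> deriv_at h t dh -> deriv_at (fun r => f r * h r) t (df * h t + f t * dh).
Proof.
move=> d1 d2; have d : deriv_at (fun r => f r * h r) t (f t * dh + h t * df).
  exact: (is_deriveM d1 d2).
by apply: deriv_at_eq d _; rewrite addrC mulrC.
Qed.

Lemma deriv_atZ (a : R) (h : R -> R) (t dh : R) :
  deriv_at h t dh -> deriv_at (fun r => a * h r) t (a * dh).
Proof.
by move=> d; apply: deriv_at_eq (deriv_atM (deriv_at_cst a t) d) _; rewrite mul0r add0r.
Qed.

Lemma deriv_at_sum (I : Type) (s : seq I) (f : I -> R -> R) (t : R) (df : I -> R) :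
  (forall i, deriv_at (f i) t (df i)) ->
  deriv_at (fun r => \sum_(i <- s) f i r) t (\sum_(i <- s) df i).
Proof.
move=> d; elim: s => [|i s IH].
  rewrite big_nil (_ : (fun r => _) = (fun=> 0)); first exact: deriv_at_cst.
  by apply/funext => r; rewrite big_nil.
rewrite big_cons (_ : (fun r => _) = (fun r => f i r + \sum_(j <- s) f j r)).
  exact: deriv_atD.
by apply/funext => r; rewrite big_cons.
Qed.

Lemma deriv_at_prod (I : Type) (s : seq I) (f : I -> R -> R) (t : R) :
  (forall i, exists df, deriv_at (f i) t df) ->
  exists df, deriv_at (fun r => \prod_(i <- s) f i r) t df.
Proof.
move=> d; elim: s => [|i s [df IH]].
  exists 0; rewrite (_ : (fun r => _) = (fun=> 1)); first exact: deriv_at_cst.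
  by apply/funext => r; rewrite big_nil.
have [di hi] := d i; exists (di * (\prod_(j <- s) f j t) + f i t * df).
rewrite (_ : (fun r => _) = (fun r => f i r * \prod_(j <- s) f j r)).
  exact: deriv_atM.
by apply/funext => r; rewrite big_cons.
Qed.

Definition mderiv_at m n (F : R -> 'M[R]_(m, n)) (t : R) (dF : 'M[R]_(m, n)) : Prop :=
  forall i j, deriv_at (fun r => F r i j) t (dF i j).

Lemma mderiv_at_mul m n p (F : R -> 'M[R]_(m, n)) (G : R -> 'M[R]_(n, p)) t dF dG :
  mderiv_at F t dF -> mderiv_at G t dG ->
  mderiv_at (fun r => F r *m G r) t (dF *m G t + F t *m dG).
Proof.
move=> hF hG i j; rewrite (_ : (fun r => _) = (fun r => \sum_k F r i k * G r k j)); last first.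
  by apply/funext => r; rewrite mxE.
have d := deriv_at_sum (index_enum _) (fun k => deriv_atM (hF i k) (hG k j)).
by apply: deriv_at_eq d _; rewrite !mxE -big_split.
Qed.

Lemma mderiv_at_tr n (F : R -> 'M[R]_n) t dF :
  mderiv_at F t dF -> deriv_at (fun r => \tr (F r)) t (\tr dF).
Proof. by move=> hF; apply: deriv_at_sum => i; apply: hF. Qed.

Lemma mderiv_at_trmx m n (F : R -> 'M[R]_(m, n)) t dF :
  mderiv_at F t dF -> mderiv_at (fun r => (F r)^T) t dF^T.
Proof.
move=> hF i j; rewrite mxE (_ : (fun r => _) = (fun r => F r j i)); first exact: hF.
by apply/funext => r; rewrite mxE.
Qed.

Lemma deriv_at_det n (F : R -> 'M[R]_n) t :
  (forall i j, exists df, deriv_at (fun r => F r i j) t df) ->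
  exists df, deriv_at (fun r => \det (F r)) t df.
Proof.
move=> hF.
have hp (s : 'S_n) : exists df, deriv_at (fun r => \prod_i F r i (s i)) t df.
  by apply: deriv_at_prod => i; exact: hF.
have [df hdf] := choice hp.
exists (\sum_(s : 'S_n) (-1) ^+ s * df s).
by apply: deriv_at_sum => s; apply: deriv_atZ.
Qed.

Lemma deriv_atV (f : R -> R) (t df : R) : deriv_at f t df -> f t != 0 ->
  exists dh, deriv_at (fun r => (f r)^-1) t dh.
Proof.
move=> [d _] f0; eexists; apply/derivableP.
exact: (derivableV f0 d).
Qed.

(** Cramer's rule: the entries of the inverse are rational in those of F. *)
Lemma mderiv_at_inv_ex n (F : R -> 'M[R]_n) t dF :
  mderiv_at F t dF -> (\forall r \near (t : R^o), F r \in unitmx) ->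
  exists dG, mderiv_at (fun r => invmx (F r)) t dG.
Proof.
move=> hF uF.
have hF' i j : exists df, deriv_at (fun r => F r i j) t df by exists (dF i j).
have [ddet hdet] := deriv_at_det hF'.
have det0 : \det (F t) != 0.
  by have := nbhs_singleton uF; rewrite unitmxE unitfE.
have [dinv hinv] := deriv_atV hdet det0.
have hc i j : exists df, deriv_at (fun r => invmx (F r) i j) t df.
  have [dm hm] : exists df, deriv_at (fun r => \det (row' j (col' i (F r)))) t df.
    apply: deriv_at_det => k l.
    rewrite (_ : (fun r => _) = (fun r => F r (lift j k) (lift i l))) //.
    by apply/funext => r; rewrite !mxE.
  exists (dinv * ((-1) ^+ (j + i) * \det (row' j (col' i (F t))))
          + (\det (F t))^-1 * ((-1) ^+ (j + i) * dm)).
  apply: deriv_at_near_eq (deriv_atM hinv (deriv_atZ ((-1) ^+ (j + i)) hm)).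
  by apply: filterS uF => r ur; rewrite /invmx ur !mxE.
exists (\matrix_(i, j) projT1 (choice (hc i)) j) => i j; rewrite mxE.
exact: (projT2 (choice (hc i))).
Qed.

(** Once the inverse is known to be differentiable, the product rule applied to
    F F^-1 = 1 gives its derivative. *)
Lemma mderiv_at_inv n (F : R -> 'M[R]_n) t dF :
  mderiv_at F t dF -> (\forall r \near (t : R^o), F r \in unitmx) -> F t = 1%:M ->
  mderiv_at (fun r => invmx (F r)) t (- dF).
Proof.
move=> hF uF F1; have [dG hG] := mderiv_at_inv_ex hF uF.
have hm := mderiv_at_mul hF hG.
suff -> : - dF = dG by [].
apply/eqP; rewrite eq_sym -addr_eq0 addrC; apply/eqP/matrixP => i j; rewrite [RHS]mxE.
have := hm i j; rewrite F1 invmx1 mulmx1 mul1mx => d.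
have d0 : deriv_at (fun r => (F r *m invmx (F r)) i j) t 0.
  apply: deriv_at_near_eq (deriv_at_cst ((1%:M : 'M[R]_n) i j) t).
  by apply: filterS uF => r ur; rewrite mulmxV.
exact: (deriv_at_unique d d0).
Qed.

Lemma constant_of_deriv0 (f : R -> R) (eps : R) :
  (forall r, `|r| < eps -> deriv_at f r 0) ->
  forall r t, `|r| < eps -> `|t| < eps -> f r = f t.
Proof.
move=> d r t; wlog rt : r t / r <= t.
  by move=> W hr ht; case: (leP r t) => [/W|/ltW/W]; [|move=> ->]; auto.
move=> hr ht.
have inI y : r <= y <= t -> `|y| < eps.
  by move: hr ht; rewrite !ltr_norml => /andP[? ?] /andP[? ?] /andP[? ?]; apply/andP; split; lra.
have [c _] : exists2 c, c \in `[r, t]%R & f t - f r = 0 * (t - r).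
  apply: (MVT_segment (df := fun=> 0)) => // [y|].
    by rewrite in_itv /= => /andP[? ?]; apply: d; apply: inI; rewrite !ltW.
  apply: derivable_within_continuous => y; rewrite in_itv /= => hy.
  by have [] := d y (inI y hy).
by rewrite mul0r => /subr0_eq.
Qed.

Lemma near_lt_norm (eps t : R) : `|t| < eps -> \forall r \near (t : R^o), `|r : R| < eps.
Proof.
move=> ht; have := @ball_open _ R^o (0 : R^o) eps; rewrite openE => /(_ t).
rewrite /interior -ball_normE /= sub0r normrN => /(_ ht).
by apply: filterS => r; rewrite /= sub0r normrN.
Qed.

End TimeDerivative.

(** * Change of frame *)

Section FrameChange.
Variables (R : realType) (m : nat) (M : manifold R m).
Variables (g g' : tensor2 M) (nabla nabla' : connection M) (U : set M).
Variables (D1 D2 : plane_field M) (k1 k2 : nat).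
Variables (e u : 'I_k1 -> vfield M) (f f' : 'I_k2 -> vfield M).
Hypothesis He : splitting g nabla U D1 D2 e f.
Hypothesis Hu : splitting g' nabla' U D1 D2 u f'.
Variable x : M.
Hypothesis Ux : U x.

(** Row a holds the components of e_a in the frame u, which is orthonormal for g'
    but not for g. *)
Definition change_mx : 'M[R]_k1 := \matrix_(a, c) g' x (e a x) (u c x).
Definition gram_mx : 'M[R]_k1 := \matrix_(c, d) g x (u c x) (u d x).

Lemma change_mxE a y : U y -> e a y = \sum_c g' y (e a y) (u c y) *: u c y.
Proof. by move=> Uy; apply: (frame_expand Hu Uy); apply: (frame_in He). Qed.

Lemma gram_change : change_mx *m gram_mx *m change_mx^T = 1%:M.
Proof.
apply/matrixP => a b; rewrite [RHS]mxE -(frame_orthonormal He a b Ux).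
rewrite {1}(change_mxE a Ux) (change_mxE b Ux) (tensor_suml (split_sym He) I) mxE.
under eq_bigr do rewrite !mxE mulr_suml.
rewrite exchange_big; apply: eq_bigr => c _ /=.
rewrite (tensorZl (split_sym He) I) (tensor_sumr (split_sym He) I) mulr_sumr.
apply: eq_bigr => d _; rewrite !mxE (tensorZr (split_sym He) I).
by rewrite -mulrA; congr (_ * _); rewrite mulrC.
Qed.

Lemma change_gram_inv : gram_mx \in unitmx /\ change_mx^T *m change_mx = invmx gram_mx.
Proof.
have e1 : gram_mx *m (change_mx^T *m change_mx) = 1%:M.
  by rewrite mulmxA; apply: mulmx1C; rewrite mulmxA gram_change.
have [ug _] := mulmx1_unit e1; split=> //.
by rewrite -[LHS](mulKmx ug) e1 mulmx1.
Qed.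

Lemma normal_mx_change i :
  \matrix_(a, b) normal_coef g nabla e f x i a b
  = change_mx *m (\matrix_(a, b) normal_coef g nabla u f x i a b) *m change_mx^T.
Proof.
apply/matrixP => a b; rewrite !mxE.
rewrite (normal_coef_change He (A := fun a c y => g' y (e a y) (u c y)) (u := u)) //.
- under [RHS]eq_bigr do rewrite !mxE mulr_suml.
  rewrite [RHS]exchange_big; apply: eq_bigr => c _ /=; apply: eq_bigr => d _.
  by rewrite !mxE mulrAC.
- by move=> a' c; apply: (smooth_pairing Hu); [apply: (frame_smooth He)|apply: (frame_smooth Hu)].
- by move=> c; apply: (frame_smooth Hu).
- by move=> c; apply: (frame_in Hu).
- by move=> a'; apply: (near_domain Hu Ux) => y; apply: change_mxE.
Qed.

Lemma sym_mx_normal (v : 'I_k1 -> vfield M) i :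
  sym_mx g nabla v f x i = 2^-1 *: ((\matrix_(a, b) normal_coef g nabla v f x i a b)
     + (\matrix_(a, b) normal_coef g nabla v f x i a b)^T).
Proof. by apply/matrixP => a b; rewrite !mxE. Qed.

Lemma skew_mx_normal (v : 'I_k1 -> vfield M) i :
  skew_mx g nabla v f x i = 2^-1 *: ((\matrix_(a, b) normal_coef g nabla v f x i a b)
     - (\matrix_(a, b) normal_coef g nabla v f x i a b)^T).
Proof. by apply/matrixP => a b; rewrite !mxE. Qed.

Lemma sym_mx_change i :
  sym_mx g nabla e f x i = change_mx *m sym_mx g nabla u f x i *m change_mx^T.
Proof.
rewrite !sym_mx_normal normal_mx_change !trmx_mul trmxK mulmxA.
by rewrite -scalemxAr -scalemxAl mulmxDr mulmxDl.
Qed.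

Lemma skew_mx_change i :
  skew_mx g nabla e f x i = change_mx *m skew_mx g nabla u f x i *m change_mx^T.
Proof.
rewrite !skew_mx_normal normal_mx_change !trmx_mul trmxK mulmxA.
by rewrite -scalemxAr -scalemxAl mulmxBr mulmxBl.
Qed.

Lemma mxtrace_change (P Q : 'M[R]_k1) : P = change_mx *m Q *m change_mx^T ->
  \tr P = \tr (invmx gram_mx *m Q).
Proof.
move=> ->; have [_ <-] := change_gram_inv.
by rewrite mxtrace_mulC mulmxA.
Qed.

(** A quadratic expression in an orthonormal frame, computed in another one:
    only A^T A, the inverse Gram matrix, enters. *)
Lemma mxtrace_sqr_change (P Q : 'M[R]_k1) : P = change_mx *m Q *m change_mx^T ->
  \tr (P *m P^T) = \tr (invmx gram_mx *m Q *m (invmx gram_mx *m Q^T)).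
Proof.
move=> ->; have [_ <-] := change_gram_inv.
by rewrite !trmx_mul trmxK !mulmxA mxtrace_mulC !mulmxA.
Qed.
End FrameChange.

Section Norms.
Variables (R : realType) (m : nat) (M : manifold R m).
Variables (g : tensor2 M) (nabla : connection M) (U : set M).
Variables (D1 D2 : plane_field M) (k1 k2 : nat).
Variables (e : 'I_k1 -> vfield M) (f : 'I_k2 -> vfield M).
Hypothesis H : splitting g nabla U D1 D2 e f.
Variable x : M.
Hypothesis Ux : U x.

Let tr_sqr (P : 'M[R]_k1) (b : 'I_k1 -> 'I_k1 -> R) : P = \matrix_(a, c) b a c ->
  \sum_a \sum_c b a c ^+ 2 = \tr (P *m P^T).
Proof.
move=> ->; rewrite mxtrace_mul_tr; apply: eq_bigr => a _; apply: eq_bigr => c _.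
by rewrite mxE expr2.
Qed.

Lemma norm_second_form : sqnorm2 e g (second_form nabla D1 D2) x
  = \sum_i \tr (sym_mx g nabla e f x i *m (sym_mx g nabla e f x i)^T).
Proof. by rewrite (sqnorm2E H (second_formE H)) //; apply: eq_bigr => i _; apply: tr_sqr. Qed.

Lemma norm_integrability : sqnorm2 e g (integrability D1 D2) x
  = \sum_i \tr (skew_mx g nabla e f x i *m (skew_mx g nabla e f x i)^T).
Proof. by rewrite (sqnorm2E H (integrabilityE H)) //; apply: eq_bigr => i _; apply: tr_sqr. Qed.

Lemma norm_mean_curvature : sqnorm g (trace_vf e (second_form nabla D1 D2)) x
  = \sum_i (\tr (sym_mx g nabla e f x i)) ^+ 2.
Proof.
rewrite (sqnorm_traceE H (second_formE H)) //; apply: eq_bigr => i _; congr (_ ^+ 2).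
by apply: eq_bigr => a _; rewrite mxE.
Qed.
End Norms.

Section FrameIndependence.
Variables (R : realType) (m : nat) (M : manifold R m).
Variables (g : tensor2 M) (nabla : connection M) (U : set M).
Variables (D1 D2 : plane_field M) (k1 k2 : nat).
Variables (e u : 'I_k1 -> vfield M) (f : 'I_k2 -> vfield M).
Hypothesis He : splitting g nabla U D1 D2 e f.
Hypothesis Hu : splitting g nabla U D1 D2 u f.
Variable x : M.
Hypothesis Ux : U x.

Let gram1 : gram_mx g u x = 1%:M.
Proof. by apply/matrixP => a b; rewrite !mxE (frame_orthonormal Hu). Qed.

Lemma norm_second_form_frame : sqnorm2 e g (second_form nabla D1 D2) x
  = sqnorm2 u g (second_form nabla D1 D2) x.
Proof.
rewrite (norm_second_form He) // (norm_second_form Hu) //; apply: eq_bigr => i _.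
rewrite (mxtrace_sqr_change He Hu Ux (sym_mx_change He Hu Ux i)).
by rewrite gram1 invmx1 !mul1mx.
Qed.

Lemma norm_integrability_frame : sqnorm2 e g (integrability D1 D2) x
  = sqnorm2 u g (integrability D1 D2) x.
Proof.
rewrite (norm_integrability He) // (norm_integrability Hu) //; apply: eq_bigr => i _.
rewrite (mxtrace_sqr_change He Hu Ux (skew_mx_change He Hu Ux i)).
by rewrite gram1 invmx1 !mul1mx.
Qed.

Lemma norm_mean_curvature_frame : sqnorm g (trace_vf e (second_form nabla D1 D2)) x
  = sqnorm g (trace_vf u (second_form nabla D1 D2)) x.
Proof.
rewrite (norm_mean_curvature He) // (norm_mean_curvature Hu) //; apply: eq_bigr => i _.
by rewrite (mxtrace_change He Hu Ux (sym_mx_change He Hu Ux i)) gram1 invmx1 mul1mx.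
Qed.
End FrameIndependence.

(** * Derivatives of the norms along a variation *)

Section Family.
Variables (R : realType) (m : nat) (M : manifold R m).
Variables (eps : R) (g : R -> tensor2 M) (nabla : R -> connection M) (U : set M).
Variables (D1 D2 : plane_field M) (k1 k2 : nat).
Variables (e : R -> 'I_k1 -> vfield M) (f : R -> 'I_k2 -> vfield M).
Hypothesis g_smooth : smooth_family eps g.
Hypothesis H : forall t, `|t| < eps -> splitting (g t) (nabla t) U D1 D2 (e t) (f t).
Let S := dt_metric g.
Hypothesis S_null : forall t, `|t| < eps -> null_on D2 D1 (S t).

Let sg r : `|r| < eps -> symmetric_tensor setT (g r).
Proof. by move=> /H/split_sym. Qed.

Lemma dt_sym t : `|t| < eps -> symmetric_tensor setT (S t).
Proof. exact: dt_metric_sym. Qed.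

Lemma dt_null t x u v : `|t| < eps -> u \in D2 x -> S t x u v = 0.
Proof.
move=> ht uD; rewrite -(component_id (split_dir (splitting_swap (H ht))) uD).
exact: S_null.
Qed.

Lemma dt_smooth t V X Y : `|t| < eps -> open V -> smooth_vf V X -> smooth_vf V Y ->
  smooth_fun V (on_fields (S t) X Y).
Proof. by move=> ht; apply: (smooth_dt_metric g_smooth sg). Qed.

Lemma metric_deriv t x u v : `|t| < eps -> deriv_at (fun r => g r x u v) t (S t x u v).
Proof. by move=> ht; apply: (is_derive_family g_smooth). Qed.

(** The derivative in time is S(u, v) = 0. *)
Lemma metric_const r t x u v : `|r| < eps -> `|t| < eps -> v \in D2 x ->
  g r x u v = g t x u v.
Proof.
move=> hr ht vD; apply: (constant_of_deriv0 (eps := eps) (f := fun r => g r x u v)) => // s hs.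
have := metric_deriv x u v hs.
by rewrite (tensorC (dt_sym hs) I) dt_null.
Qed.

Section AtTime.
Variables (t : R) (x : M).
Hypotheses (ht : `|t| < eps) (Ux : U x).

(** The frame of D2 of time t serves at all times, since the metric of D2 is
    constant. *)
Lemma splitting_fixed r : `|r| < eps -> splitting (g r) (nabla r) U D1 D2 (e r) (f t).
Proof.
move=> hr; case: (H hr) => *; split=> //.
have [sf f2] := split_frame2 (H ht); split=> // y Uy; have [fD fo] := f2 y Uy.
by split=> // a b; rewrite (metric_const _ hr ht) // fo.
Qed.

Let H0 := splitting_fixed.
Let Ht := H ht.
Let near_eps := near_lt_norm ht.

Definition gram r := gram_mx (g r) (e t) x.
Definition dgram := tensor_mx (e t) (S t) x.

Lemma gram_deriv : mderiv_at gram t dgram.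
Proof.
move=> a b; rewrite mxE; apply: deriv_at_near_eq (metric_deriv x _ _ ht).
by apply: filterS near_eps => r _; rewrite mxE.
Qed.

Lemma gram_t : gram t = 1%:M.
Proof. by apply/matrixP => a b; rewrite !mxE (frame_orthonormal Ht). Qed.

Lemma gram_unit r : `|r| < eps -> gram r \in unitmx.
Proof. by move=> hr; have [] := change_gram_inv (H0 hr) Ht Ux. Qed.

Lemma inv_gram_deriv : mderiv_at (fun r => invmx (gram r)) t (- dgram).
Proof.
apply: (mderiv_at_inv gram_deriv _ gram_t).
by apply: filterS near_eps => r; apply: gram_unit.
Qed.

Let psi r i := sym_mx (g r) (nabla r) (e t) (f t) x i.
Let sigma r i := skew_mx (g r) (nabla r) (e t) (f t) x i.
Let theta r c := sym_mx (g r) (nabla r) (f t) (e t) x c.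

Let e_sm a : smooth_vf_near x (e t a). Proof. exact: (frame_smooth Ht). Qed.
Let f_sm i : smooth_vf_near x (f t i). Proof. exact: (frame_smooth (splitting_swap Ht)). Qed.
Let e_D1 y a : U y -> e t a y \in D1 y. Proof. exact: (frame_in Ht). Qed.
Let f_D2 y i : U y -> f t i y \in D2 y. Proof. exact: (frame_in (splitting_swap Ht)). Qed.

Definition lie_mx i := \matrix_(a, b) S t x (bracket (e t a) (f t i) x) (e t b x).

(** At each time the matrix of h in the fixed frames is given by [koszul], which
    involves time only through the metric. *)
Lemma psi_deriv i : mderiv_at (fun r => psi r i) t
  (- 2^-1 *: (dtensor_mx (e t) (f t) (S t) x i + lie_mx i + (lie_mx i)^T)).
Proof.
move=> a b; rewrite !mxE.
have d1 := metric_deriv x (bracket (e t a) (f t i) x) (e t b x) ht.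
have d2 := metric_deriv x (bracket (e t b) (f t i) x) (e t a x) ht.
have d0 : deriv_at (fun r => dirder x (f t i x) (on_fields (g r) (e t a) (e t b))) t
   (dirder x (f t i x) (on_fields (S t) (e t a) (e t b))).
  by apply: (is_derive_dirder g_smooth sg).
apply: deriv_at_near_eq (deriv_atZ (- 2^-1) (deriv_atD (deriv_atD d0 d1) d2)).
apply: filterS near_eps => r hr; rewrite /psi mxE /sym_coef /normal_coef.
rewrite (koszul (H0 hr) (X := e t a) (Y := e t b) (N := f t i)) //; first by rewrite mulrN mulNr.
  by apply: (near_domain Ht Ux) => y Uy; apply: (orth12 (H0 hr)); auto.
by apply: (near_domain Ht Ux) => y Uy; apply: (orth12 (H0 hr)); auto.
Qed.

(** T is a bracket, and its products with D2 do not vary. *)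
Lemma sigma_const r i : `|r| < eps -> sigma r i = sigma t i.
Proof.
move=> hr; apply/matrixP => a b; rewrite !mxE /skew_coef /normal_coef; congr (_ * _).
have br s : `|s| < eps -> g s x (nabla s x (e t a x) (e t b)) (f t i x)
    - g s x (nabla s x (e t b x) (e t a)) (f t i x)
    = g s x (bracket (e t a) (e t b) x) (f t i x).
  by move=> hs; rewrite (bracket_cov (H hs)) // (tensorBl (sg hs) I).
by rewrite !br // (metric_const _ hr ht) // f_D2.
Qed.

(** In the Koszul formula for the form of D2, g(f_i, f_j) is constant on U and the
    remaining products are with elements of D2. *)
Lemma theta_const r c : `|r| < eps -> theta r c = theta t c.
Proof.
move=> hr; apply/matrixP => i j; rewrite !mxE /sym_coef /normal_coef; congr (_ * _).
have kz s : `|s| < eps -> g s x (nabla s x (f t i x) (f t j)) (e t c x)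
    + g s x (nabla s x (f t j x) (f t i)) (e t c x)
    = - (g s x (bracket (f t i) (e t c) x) (f t j x) + g s x (bracket (f t j) (e t c) x) (f t i x)).
  move=> hs; rewrite (koszul (H hs) (X := f t i) (Y := f t j) (N := e t c)) //.
  - rewrite (@dirder_near_eq _ _ _ _ _ _ (fun=> (i == j)%:R)) ?dirder_cst ?add0r //.
    apply: (near_domain Ht Ux) => y Uy.
    by rewrite /on_fields (frame_orthonormal (splitting_swap (splitting_fixed hs))).
  - by apply: (near_domain Ht Ux) => y Uy; apply: (orth21 (H hs)); auto.
  - by apply: (near_domain Ht Ux) => y Uy; apply: (orth21 (H hs)); auto.
by rewrite !kz // !(metric_const _ hr ht) // f_D2.
Qed.

Lemma deriv_gram_bilin (P : R -> 'M[R]_k1) dP (Q : R -> 'M[R]_k1) dQ :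
  mderiv_at P t dP -> mderiv_at Q t dQ ->
  deriv_at (fun r => \tr (invmx (gram r) *m P r *m (invmx (gram r) *m Q r))) t
   (\tr (dP *m Q t) + \tr (P t *m dQ) - \tr (dgram *m (P t *m Q t)) - \tr (dgram *m (Q t *m P t))).
Proof.
move=> hP hQ.
have d := mderiv_at_mul (mderiv_at_mul inv_gram_deriv hP) (mderiv_at_mul inv_gram_deriv hQ).
apply: deriv_at_eq (mderiv_at_tr d) _.
rewrite gram_t invmx1 !mul1mx !mulNmx !mulmxDl !mulmxDr !mulNmx !mulmxN !raddfD /= !raddfN /=.
rewrite (mxtrace_mulC (P t)) !mulmxA; ring.
Qed.

Lemma deriv_gram_lin (P : R -> 'M[R]_k1) dP : mderiv_at P t dP ->
  deriv_at (fun r => \tr (invmx (gram r) *m P r)) t (\tr dP - \tr (dgram *m P t)).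
Proof.
move=> hP; apply: deriv_at_eq (mderiv_at_tr (mderiv_at_mul inv_gram_deriv hP)) _.
by rewrite gram_t invmx1 mul1mx mulNmx raddfD /= raddfN /= addrC.
Qed.

Let Phi i := sym_mx (g t) (nabla t) (e t) (f t) x i.
Let Tau i := skew_mx (g t) (nabla t) (e t) (f t) x i.
Let Con i := conn_mx (g t) (nabla t) (e t) (f t) x i.
Let G i := dtensor_mx (e t) (f t) (S t) x i.

Lemma lie_mxE i : lie_mx i = - ((Phi i + Tau i + Con i) *m dgram).
Proof.
apply: (bracket_tensor Ht (dt_sym ht) _ i Ux) => y u v.
exact: dt_null.
Qed.

Lemma deriv_norm_h :
  deriv_at (fun r => sqnorm2 (e r) (g r) (second_form (nabla r) D1 D2) x) t
   (\sum_i (\tr ((Phi i *m Tau i - Tau i *m Phi i - Con i *m Phi i - (Con i *m Phi i)^T) *m dgram)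
       - \tr (Phi i *m G i))).
Proof.
have d := deriv_at_sum (index_enum 'I_k2)
  (fun i => deriv_gram_bilin (psi_deriv i) (mderiv_at_trmx (psi_deriv i))).
apply: deriv_at_near_eq (deriv_at_eq d _).
  apply: filterS near_eps => r hr; rewrite (norm_second_form (H0 hr)) //.
  apply: eq_bigr => i _.
  by rewrite (mxtrace_sqr_change (H0 hr) Ht Ux (sym_mx_change (H0 hr) Ht Ux i)).
apply: eq_bigr => i _.
rewrite -(@variation_algebra _ _ (Phi i) (Tau i) (Con i) dgram (G i)).  
- rewrite -!lie_mxE -/(Phi i) /psi -/(Phi i) sym_mxT -/(Phi i).
  (* Phi_i is symmetric, so K may be transposed inside the trace *)
  set K := _ *: _; have -> : \tr (Phi i *m K^T) = \tr (Phi i *m K).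
    by rewrite -[LHS]mxtrace_tr trmx_mul trmxK sym_mxT mxtrace_mulC.
  by rewrite [\tr (K *m _)]mxtrace_mulC; ring.
- exact: sym_mxT.
- exact: skew_mxT.
- exact: (conn_mxT Ht).
- exact: (tensor_mxT _ (dt_sym ht)).
Qed.

Lemma deriv_norm_H :
  deriv_at (fun r => sqnorm (g r) (trace_vf (e r) (second_form (nabla r) D1 D2)) x) t
   (- \sum_i \tr (Phi i) * \tr (G i)).
Proof.
have d := deriv_at_sum (index_enum 'I_k2)
  (fun i => deriv_atM (deriv_gram_lin (psi_deriv i)) (deriv_gram_lin (psi_deriv i))).
apply: deriv_at_near_eq (deriv_at_eq d _).
  apply: filterS near_eps => r hr; rewrite (norm_mean_curvature (H0 hr)) //.
  apply: eq_bigr => i _.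
  by rewrite (mxtrace_change (H0 hr) Ht Ux (sym_mx_change (H0 hr) Ht Ux i)) expr2.
rewrite -sumrN; apply: eq_bigr => i _.
have sD : dgram^T = dgram by exact: (tensor_mxT _ (dt_sym ht)).
rewrite gram_t invmx1 !mul1mx /psi -/(Phi i) linearZ /= !raddfD /= mxtrace_tr -/(G i).
rewrite lie_mxE raddfN /= !mulmxDl !raddfD /=.
rewrite (mxtrace_skew (skew_mxT _ _ _ _ _ _) sD) (mxtrace_skew (conn_mxT Ht _ Ux) sD).
rewrite (mxtrace_mulC dgram) -/(Phi i); by field.
Qed.

Lemma deriv_norm_T :
  deriv_at (fun r => sqnorm2 (e r) (g r) (integrability D1 D2) x) t
   (\sum_i 2 * \tr (dgram *m (Tau i *m Tau i))).
Proof.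
have c0 (P : 'M[R]_k1) : mderiv_at (fun=> P) t 0 by move=> a b; rewrite mxE; apply: deriv_at_cst.
have d := deriv_at_sum (index_enum 'I_k2) (fun i => deriv_gram_bilin (c0 (Tau i)) (c0 (Tau i)^T)).
apply: deriv_at_near_eq (deriv_at_eq d _).
  apply: filterS near_eps => r hr; rewrite (norm_integrability (H0 hr)) //.
  apply: eq_bigr => i _.
  rewrite (mxtrace_sqr_change (H0 hr) Ht Ux (skew_mx_change (H0 hr) Ht Ux i)).
  by rewrite -/(sigma r i) sigma_const.
apply: eq_bigr => i _; rewrite mul0mx mulmx0 !raddf0 skew_mxT !mulmxN !mulNmx !mulmxN !raddfN /=.
rewrite -/(Tau i); ring.
Qed.

Let Qf r hr := splitting_swap (splitting_fixed (r := r) hr).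

(** The value of the form of D2 is a vector of D1; only the frame in which its
    components are taken changes. *)
Lemma theta_change r a i j : `|r| < eps ->
  sym_coef (g r) (nabla r) (f t) (e r) x a i j
  = \sum_c change_mx (g t) (e r) (e t) x a c * theta t c i j.
Proof.
move=> hr; rewrite /sym_coef /normal_coef {1 2}(change_mxE (H0 hr) Ht a Ux).
rewrite !(tensor_sumr (sg hr) I) -big_split /= mulr_sumr; apply: eq_bigr => c _.
rewrite !(tensorZr (sg hr) I) -mulrDr mulrCA -(theta_const c hr) !mxE; congr (_ * _).
Qed.

Lemma sum_sqr_change r (w : 'I_k1 -> R) : `|r| < eps ->
  \sum_a (\sum_c change_mx (g t) (e r) (e t) x a c * w c) ^+ 2
  = \tr (invmx (gram r) *m (\matrix_(c, d) (w c * w d))).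
Proof.
move=> hr; have [_ <-] := change_gram_inv (H0 hr) Ht Ux.
set A := change_mx _ _ _ _; rewrite -mulmxA mxtrace_mulE exchange_big; apply: eq_bigr => a _ /=.
rewrite expr2 mulr_suml; apply: eq_bigr => c _; rewrite !mxE [in RHS]mulr_sumr.
rewrite mulr_sumr; apply: eq_bigr => d _; rewrite !mxE; ring.
Qed.

Let ht' r := second_form (nabla r) D2 D1.

(** The trace is the square norm at time r of the vector of D1 whose products with
    the frame e are the constants w_c; at time t it is the sum of the w_c e_c. *)
Lemma deriv_sum_sqr (w : 'I_k1 -> R) : 
  deriv_at (fun r => \tr (invmx (gram r) *m (\matrix_(c, d) (w c * w d)))) t
   (- S t x (\sum_c w c *: e t c x) (\sum_c w c *: e t c x)).
Proof.
have c0 (P : 'M[R]_k1) : mderiv_at (fun=> P) t 0 by move=> a b; rewrite mxE; apply: deriv_at_cst.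
apply: deriv_at_eq (deriv_gram_lin (c0 _)) _; rewrite raddf0 sub0r; congr (- _).
rewrite mxtrace_mulE (tensor_suml (dt_sym ht) I); apply: eq_bigr => c _.
rewrite (tensorZl (dt_sym ht) I) (tensor_sumr (dt_sym ht) I) mulr_sumr; apply: eq_bigr => d _.
rewrite !mxE (tensorZr (dt_sym ht) I); ring.
Qed.

Lemma deriv_norm_ht :
  deriv_at (fun r => sqnorm2 (f r) (g r) (ht' r) x) t (- sum_along (f t) (ht' t) (S t) x).
Proof.
have d := deriv_at_sum (index_enum 'I_k2) (fun i => deriv_at_sum (index_enum 'I_k2)
  (fun j => deriv_sum_sqr (fun c => theta t c i j))).
apply: deriv_at_near_eq (deriv_at_eq d _).
  apply: filterS near_eps => r hr.
  rewrite (norm_second_form_frame (splitting_swap (H hr)) (Qf hr) Ux).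
  rewrite (sqnorm2E (Qf hr) (second_formE (Qf hr)) Ux) [RHS]exchange_big; apply: eq_bigr => i _ /=.
  rewrite [RHS]exchange_big; apply: eq_bigr => j _ /=.
  by rewrite -sum_sqr_change //; apply: eq_bigr => a _; rewrite theta_change.
rewrite /sum_along -sumrN; apply: eq_bigr => i _; rewrite -sumrN; apply: eq_bigr => j _.
congr (- _); rewrite /ht' (frame_opE (Qf ht) _ _ (second_formE (Qf ht))) //.
by congr (S t x _ _); apply: eq_bigr => c _; rewrite mxE.
Qed.

Lemma deriv_norm_Ht :
  deriv_at (fun r => sqnorm (g r) (trace_vf (f r) (ht' r)) x) t
   (- S t x (trace_vf (f t) (ht' t) x) (trace_vf (f t) (ht' t) x)).
Proof.
apply: deriv_at_near_eq (deriv_at_eq (deriv_sum_sqr (fun c => \sum_i theta t c i i)) _).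
  apply: filterS near_eps => r hr.
  rewrite (norm_mean_curvature_frame (splitting_swap (H hr)) (Qf hr) Ux).
  rewrite (sqnorm_traceE (Qf hr) (second_formE (Qf hr)) Ux) -sum_sqr_change //.
  apply: eq_bigr => a _; congr (_ ^+ 2).
  under [RHS]eq_bigr do rewrite theta_change //.
  by rewrite exchange_big; apply: eq_bigr => c _; rewrite mulr_sumr.
congr (- _); have -> : trace_vf (f t) (ht' t) x = \sum_c (\sum_i theta t c i i) *: e t c x.
  rewrite /trace_vf; under eq_bigr do rewrite /ht' (frame_opE (Qf ht) _ _ (second_formE (Qf ht))) //.
  rewrite exchange_big; apply: eq_bigr => c _; rewrite scaler_suml.
  by apply: eq_bigr => i _; rewrite mxE.
by [].
Qed.

(** The vectors Tt(f_i, f_j) do not depend on time, only the metric measuring them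
    does. *)
Lemma deriv_norm_Tt :
  deriv_at (fun r => sqnorm2 (f r) (g r) (integrability D2 D1) x) t
   (sum_along (f t) (integrability D2 D1) (S t) x).
Proof.
apply: (@deriv_at_near_eq _ (fun r => sqnorm2 (f t) (g r) (integrability D2 D1) x)).
  apply: filterS near_eps => r hr.
  by rewrite (norm_integrability_frame (splitting_swap (H hr)) (Qf hr) Ux).
by apply: deriv_at_sum => i; apply: deriv_at_sum => j; apply: metric_deriv.
Qed.

End AtTime.
End Family.

(** * The variation formulas *)

Section Swap.
Variables (R : realType) (m : nat) (M : manifold R m) (k1 k2 : nat).
Variables (e : 'I_k1 -> vfield M) (f : 'I_k2 -> vfield M).

Lemma sum_full_frame_swap (F : vfield M -> R) :
  \sum_(k : 'I_k1 + 'I_k2) F (full_frame e f k) = \sum_(k : 'I_k2 + 'I_k1) F (full_frame f e k).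
Proof. by rewrite !big_sumType /= addrC. Qed.

(** Exchanging D1 and D2 reverses the order of the two frames in the full frame;
    this and the next three lemmas undo it. *)
Lemma inner2_swap (b c : field_form M) : inner2 e f b c = inner2 f e b c.
Proof.
apply/funext => x; rewrite /inner2.
rewrite (sum_full_frame_swap (fun X => \sum_l b X (full_frame e f l) x * c X (full_frame e f l) x)).
by apply: eq_bigr => k _; rewrite (sum_full_frame_swap (fun Y => b _ Y x * c _ Y x)).
Qed.

Lemma trace2_swap (S : tensor2 M) : trace2 e f S = trace2 f e S.
Proof. by apply/funext => x; rewrite /trace2 (sum_full_frame_swap (fun X => S x (X x) (X x))). Qed.

Lemma div_op2_swap g nabla (P : field_op2 M) : div_op2 e f g nabla P = div_op2 f e g nabla P.
Proof.
apply/funext => X; apply/funext => Y; apply/funext => x.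
by rewrite /div_op2 (sum_full_frame_swap (fun V => g x (cov_op2 nabla V P X Y x) (V x))).
Qed.

Lemma represents_swap U D1 D2 q Phi :
  represents e f U D1 D2 q Phi = represents f e U D1 D2 q Phi.
Proof.
rewrite /represents; congr and3; apply/propext.
by split=> h S sS nS x Ux; rewrite -h // inner2_swap.
Qed.
End Swap.

Section Variation.
Variables (R : realType) (m : nat) (M : manifold R m).
Variables (eps : R) (g : R -> tensor2 M) (nabla : R -> connection M) (U : set M).
Variables (D1 D2 : plane_field M) (k1 k2 : nat).
Variables (e : R -> 'I_k1 -> vfield M) (f : R -> 'I_k2 -> vfield M).
Hypothesis g_smooth : smooth_family eps g.
Hypothesis H : forall t, `|t| < eps -> splitting (g t) (nabla t) U D1 D2 (e t) (f t).

Let S := dt_metric g.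
Let inner t := inner2 (e t) (f t).
Let div t := divergence (nabla t).
Let h t := second_form (nabla t) D1 D2.
Let ht t := second_form (nabla t) D2 D1.
Let T := integrability D1 D2.
Let Tt := integrability D2 D1.
Let hH t := trace_vf (e t) (h t).
Let hHt t := trace_vf (f t) (ht t).

Lemma variation_general : (forall t, `|t| < eps -> null_on D2 D1 (S t)) ->
  forall t x, `|t| < eps -> U x ->
  [/\ deriv_at (fun r => sqnorm2 (e r) (g r) (h r) x) t
        (inner t (fun X Y y => div_op2 (e t) (f t) (g t) (nabla t) (h t) X Y y
            + flat (g t) (sum_comm (f t) (adjoint_op (g t) D1 T) (adjoint_op (g t) D1 (h t))) X Y y)
           (on_fields (S t)) x
         - div t (tensor_contraction (e t) (h t) (S t)) x),
      deriv_at (fun r => sqnorm (g r) (hH r) x) t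
        (inner t (fun X Y y => div t (hH t) y * on_fields (g t) X Y y) (on_fields (S t)) x
         - div t (fun y => trace2 (e t) (f t) (S t) y *: hH t y) x),
      forall Phi, represents (e t) (f t) U D2 D1
          (fun S x => S x (hHt t x) (hHt t x) - sum_along (f t) (ht t) S x) Phi ->
        deriv_at (fun r => sqnorm2 (f r) (g r) (ht r) x - sqnorm (g r) (hHt r) x) t
          (inner t (on_fields Phi) (on_fields (S t)) x),
      deriv_at (fun r => sqnorm2 (e r) (g r) T x) t
        (inner t (fun X Y y => 2 * flat (g t) (sum_sq (f t) (adjoint_op (g t) D1 T)) X Y y)
           (on_fields (S t)) x) &
      forall Phi, represents (e t) (f t) U D2 D1 (fun S x => - sum_along (f t) Tt S x) Phi ->
        deriv_at (fun r => sqnorm2 (f r) (g r) Tt x) t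
          (- inner t (on_fields Phi) (on_fields (S t)) x)].
Proof.
move=> S_null t x ht' Ux.
have sS := dt_sym g_smooth H ht'.
have S0 y u v : u \in D2 y -> S t y u v = 0 by move=> uD; exact: (dt_null H S_null v ht' uD).
have Ssm V X Y := @dt_smooth _ _ _ _ _ _ _ _ _ _ _ _ _ g_smooth H t V X Y ht'.
split.
- apply: deriv_at_eq (deriv_norm_h g_smooth H S_null ht' Ux) _.
  by rewrite (static_h (H ht') sS S0 Ssm Ux).
- apply: deriv_at_eq (deriv_norm_H g_smooth H S_null ht' Ux) _.
  by rewrite (static_H (H ht') sS S0 Ssm Ux).
- move=> Phi [_ _ /(_ _ sS (S_null t ht') x Ux) PhiS]; rewrite /inner PhiS.
  have d1 := deriv_norm_ht g_smooth H S_null ht' Ux.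
  have d2 := deriv_norm_Ht g_smooth H S_null ht' Ux.
  apply: (@deriv_at_near_eq _ (fun r => sqnorm2 (f r) (g r) (ht r) x + (-1) * sqnorm (g r) (hHt r) x)).
    by apply: filterS (near_lt_norm ht') => r _; rewrite mulN1r.
  apply: deriv_at_eq (deriv_atD d1 (deriv_atZ (-1) d2)) _.
  by rewrite mulN1r opprK addrC.
- apply: deriv_at_eq (deriv_norm_T g_smooth H S_null ht' Ux) _.
  by rewrite /inner /T (static_T (H ht') sS S0 Ux).
- move=> Phi [_ _ /(_ _ sS (S_null t ht') x Ux) PhiS]; rewrite /inner PhiS.
  by rewrite opprK; exact: (deriv_norm_Tt g_smooth H S_null ht' Ux).
Qed.

(** S is s times the metric on D1, so its matrix in the frame is scalar and that
    of f_i S is (f_i s) times the identity.  Traces of a skew matrix with a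
    symmetric one vanish. *)
Lemma variation_conformal (s : R -> M -> R) :
  (forall t, `|t| < eps -> smooth_fun [set: M] (s t)) ->
  (forall t x u v, `|t| < eps -> S t x u v = s t x * restrict_metric D1 D2 (g t) x u v) ->
  forall t x, `|t| < eps -> U x ->
  [/\ deriv_at (fun r => sqnorm2 (e r) (g r) (h r) x) t
        (s t x * div t (hH t) x - div t (fun y => s t y *: hH t y) x),
      deriv_at (fun r => sqnorm (g r) (hH r) x) t
        (k1%:R * (s t x * div t (hH t) x - div t (fun y => s t y *: hH t y) x))
    & [/\ deriv_at (fun r => sqnorm2 (f r) (g r) (ht r) x) t
            (- s t x * sqnorm2 (f t) (g t) (ht t) x),
          deriv_at (fun r => sqnorm (g r) (hHt r) x) t (- s t x * sqnorm (g t) (hHt t) x),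
          deriv_at (fun r => sqnorm2 (e r) (g r) T x) t
            (- (2 * s t x * sqnorm2 (e t) (g t) T x)) &
          deriv_at (fun r => sqnorm2 (f r) (g r) Tt x) t
            (s t x * sqnorm2 (f t) (g t) Tt x)]].
Proof.
move=> s_smooth S_conf t x ht' Ux; have Ht := H ht'; have sg := split_sym Ht.
have S_null r : `|r| < eps -> null_on D2 D1 (S r).
  move=> hr y u v; rewrite S_conf // /restrict_metric.
  rewrite (component_other (split_dir (H hr)) (component_in _ _ _ _)).
  by rewrite (tensor0l (split_sym (H hr)) I) mulr0.
have S_D1 y w : w \in D1 y -> S t y w w = s t y * g t y w w.
  by move=> wD; rewrite S_conf // /restrict_metric (component_id (split_dir Ht) wD).
have S_e y a b : U y -> S t y (e t a y) (e t b y) = s t y * (a == b)%:R.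
  move=> Uy; rewrite S_conf // /restrict_metric !(component_id (split_dir Ht)) ?(frame_in Ht) //.
  by rewrite (frame_orthonormal Ht).
have ss : smooth_fun_near x (s t).
  by exists setT; [split=> //; exact: openT|exact: s_smooth].
have tm : tensor_mx (e t) (S t) x = s t x *: 1%:M.
  by apply/matrixP => a b; rewrite !mxE S_e.
have dm i : dtensor_mx (e t) (f t) (S t) x i = dirder x (f t i x) (s t) *: 1%:M.
  apply/matrixP => a b; rewrite !mxE.
  rewrite (@dirder_near_eq _ _ _ x _ _ (fun y => s t y * (a == b)%:R)); last first.
    by apply: (near_domain Ht Ux) => y Uy; rewrite /on_fields S_e.
  case: (a == b); rewrite ?mulr1 ?mulr0.
    by apply: dirder_near_eq; apply: (near_domain Ht Ux) => y _; rewrite mulr1.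
  rewrite (@dirder_near_eq _ _ _ x _ _ (fun=> 0)) ?dirder_cst //.
  by apply: (near_domain Ht Ux) => y _; rewrite mulr0.
have divs : s t x * div t (hH t) x - div t (fun y => s t y *: hH t y) x
    = - \sum_i \tr (sym_mx (g t) (nabla t) (e t) (f t) x i) * dirder x (f t i x) (s t).
  rewrite /div (divergenceZ Ht) //; last exact: (smooth_trace_h Ht).
  by rewrite /hH (dirder_H Ht Ux ss); ring.
split; last split.
- apply: deriv_at_eq (deriv_norm_h g_smooth H S_null ht' Ux) _.
  rewrite divs -sumrN; apply: eq_bigr => i _; rewrite /dgram -/S tm dm -!scalemxAr !mulmx1 !mxtraceZ.
  rewrite !raddfB /= mxtrace_tr mxtrace_mulC subrr sub0r.
  rewrite (mxtrace_skew (conn_mxT Ht _ Ux) (sym_mxT _ _ _ _ _ _)).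
  ring.
- apply: deriv_at_eq (deriv_norm_H g_smooth H S_null ht' Ux) _.
  rewrite divs mulrN; congr (- _); rewrite mulr_sumr; apply: eq_bigr => i _.
  by rewrite -/S dm mxtraceZ mxtrace1; ring.
- apply: deriv_at_eq (deriv_norm_ht g_smooth H S_null ht' Ux) _.
  rewrite mulNr; congr (- _); rewrite mulr_sumr; apply: eq_bigr => i _.
  rewrite mulr_sumr; apply: eq_bigr => j _; exact: (S_D1 x _ (component_in _ _ _ _)).
- apply: deriv_at_eq (deriv_norm_Ht g_smooth H S_null ht' Ux) _.
  rewrite mulNr; congr (- _); apply: (S_D1 x).
  by apply: memv_suml => i _; exact: component_in.
- apply: deriv_at_eq (deriv_norm_T g_smooth H S_null ht' Ux) _.
  rewrite /T (norm_integrability Ht) // mulr_sumr -sumrN; apply: eq_bigr => i _.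
  rewrite /dgram -/S tm -scalemxAl mul1mx mxtraceZ skew_mxT mulmxN raddfN /=; ring.
- apply: deriv_at_eq (deriv_norm_Tt g_smooth H S_null ht' Ux) _.
  rewrite mulr_sumr; apply: eq_bigr => i _.
  rewrite mulr_sumr; apply: eq_bigr => j _; exact: (S_D1 x _ (component_in _ _ _ _)).
Qed.
End Variation.

Theorem lemma1p4 (R : realType) (n p : nat) (M : manifold R (n + p))
    (Dt D : plane_field M) (eps : R) (g : R -> tensor2 M)
    (nabla : R -> connection M)
    (U : set M) (E : R -> 'I_n -> vfield M) (F : R -> 'I_p -> vfield M)
    (M_connected : connected [set: M])
    (Dt_distr : smooth_distribution n Dt) (D_distr : smooth_distribution p D)
    (TM_decomp : direct_decomposition Dt D)
    (eps_gt0 : 0 < eps)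
    (g_smooth : smooth_family eps g)
    (g_riem : forall t, `|t| < eps -> riemannian (g t))
    (g_adapted : forall t, `|t| < eps -> adapted Dt D (g t))
    (nabla_LC : forall t, `|t| < eps -> levi_civita (g t) (nabla t))
    (U_open : open U)
    (E_frame : forall t, `|t| < eps -> orthonormal_frame (g t) Dt U (E t))
    (F_frame : forall t, `|t| < eps -> orthonormal_frame (g t) D U (F t)) :
  let S := dt_metric g in
  let inner t := inner2 (E t) (F t) in
  let Tr t := trace2 (E t) (F t) in
  let div t := divergence (nabla t) in
  let div2 t := div_op2 (E t) (F t) (g t) (nabla t) in
  let h t := second_form (nabla t) Dt D in
  let ht t := second_form (nabla t) D Dt in
  let T := integrability Dt D in
  let Tt := integrability D Dt in
  let H t := trace_vf (E t) (h t) in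
  let Ht t := trace_vf (F t) (ht t) in
  let A t := adjoint_op (g t) Dt (h t) in
  let At t := adjoint_op (g t) D (ht t) in
  let Tsharp t := adjoint_op (g t) Dt T in
  let Ttsharp t := adjoint_op (g t) D Tt in
  let calTt t := sum_sq (E t) (Ttsharp t) in
  let calT t := sum_sq (F t) (Tsharp t) in
  let calKt t := sum_comm (E t) (Ttsharp t) (At t) in
  let calK t := sum_comm (F t) (Tsharp t) (A t) in
  let nh t := sqnorm2 (E t) (g t) (h t) in
  let nht t := sqnorm2 (F t) (g t) (ht t) in
  let nT t := sqnorm2 (E t) (g t) T in
  let nTt t := sqnorm2 (F t) (g t) Tt in
  let nH t := sqnorm (g t) (H t) in
  let nHt t := sqnorm (g t) (Ht t) in
  let is_Phi_h t := represents (E t) (F t) U Dt D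
    (fun S x => S x (H t x) (H t x) - sum_along (E t) (h t) S x) in
  let is_Phi_T t := represents (E t) (F t) U Dt D
    (fun S x => - sum_along (E t) T S x) in
  let is_Phi_ht t := represents (E t) (F t) U D Dt
    (fun S x => S x (Ht t x) (Ht t x) - sum_along (F t) (ht t) S x) in
  let is_Phi_Tt t := represents (E t) (F t) U D Dt
    (fun S x => - sum_along (F t) Tt S x) in
  let dt (f : R -> M -> R) (t : R) (x : M) (df : R) :=
    is_derive (t : R^o) (1 : R^o) (fun r : R^o => f r x : R^o) (df : R^o) in
  (* (1) *)
  ((forall t, `|t| < eps -> null_on Dt D (S t)) ->
   forall t x, `|t| < eps -> U x ->
   [/\ dt nht t x
         (inner t (fun X Y y => div2 t (ht t) X Y y
                                + flat (g t) (calKt t) X Y y)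
                  (on_fields (S t)) x
          - div t (tensor_contraction (F t) (ht t) (S t)) x),
       dt nHt t x
         (inner t (fun X Y y => div t (Ht t) y * on_fields (g t) X Y y)
                  (on_fields (S t)) x
          - div t (fun y => Tr t (S t) y *: Ht t y) x),
       forall Phi_h, is_Phi_h t Phi_h ->
         dt (fun r y => nh r y - nH r y) t x
            (inner t (on_fields Phi_h) (on_fields (S t)) x),
       dt nTt t x
         (inner t (fun X Y y => 2 * flat (g t) (calTt t) X Y y)
                  (on_fields (S t)) x) &
       forall Phi_T, is_Phi_T t Phi_T ->
         dt nT t x (- inner t (on_fields Phi_T) (on_fields (S t)) x)]) /\
  (* (2) *)
  (forall s : R -> M -> R,
   (forall t, `|t| < eps -> smooth_fun [set: M] (s t)) ->
   (forall t x u v, `|t| < eps ->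
      S t x u v = s t x * restrict_metric D Dt (g t) x u v) ->
   forall t x, `|t| < eps -> U x ->
   [/\ dt nht t x
         (s t x * div t (Ht t) x - div t (fun y => s t y *: Ht t y) x)
     , dt nHt t x
         (p%:R * (s t x * div t (Ht t) x - div t (fun y => s t y *: Ht t y) x))
     & [/\ dt nh t x (- s t x * nh t x),
           dt nH t x (- s t x * nH t x),
           dt nTt t x (- (2 * s t x * nTt t x)) &
           dt nT t x (s t x * nT t x)]]) /\
  (* (3), general variations *)
  ((forall t, `|t| < eps -> null_on D Dt (S t)) ->
   forall t x, `|t| < eps -> U x ->
   [/\ dt nh t x
         (inner t (fun X Y y => div2 t (h t) X Y y
                                + flat (g t) (calK t) X Y y)
                  (on_fields (S t)) x
          - div t (tensor_contraction (E t) (h t) (S t)) x),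
       dt nH t x
         (inner t (fun X Y y => div t (H t) y * on_fields (g t) X Y y)
                  (on_fields (S t)) x
          - div t (fun y => Tr t (S t) y *: H t y) x),
       forall Phi_ht, is_Phi_ht t Phi_ht ->
         dt (fun r y => nht r y - nHt r y) t x
            (inner t (on_fields Phi_ht) (on_fields (S t)) x),
       dt nT t x
         (inner t (fun X Y y => 2 * flat (g t) (calT t) X Y y)
                  (on_fields (S t)) x) &
       forall Phi_Tt, is_Phi_Tt t Phi_Tt ->
         dt nTt t x (- inner t (on_fields Phi_Tt) (on_fields (S t)) x)]) /\
  (* (3), conformal variations *)
  (forall s : R -> M -> R,
   (forall t, `|t| < eps -> smooth_fun [set: M] (s t)) ->
   (forall t x u v, `|t| < eps ->
      S t x u v = s t x * restrict_metric Dt D (g t) x u v) ->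
   forall t x, `|t| < eps -> U x ->
   [/\ dt nh t x
         (s t x * div t (H t) x - div t (fun y => s t y *: H t y) x)
     , dt nH t x
         (n%:R * (s t x * div t (H t) x - div t (fun y => s t y *: H t y) x))
     & [/\ dt nht t x (- s t x * nht t x),
           dt nHt t x (- s t x * nHt t x),
           dt nT t x (- (2 * s t x * nT t x)) &
           dt nTt t x (s t x * nTt t x)]]).
Proof.
have SP t (ht : `|t| < eps) : splitting (g t) (nabla t) U Dt D (E t) (F t).
  have [sg pg] := g_riem t ht; split=> //.
  - by move=> V X Y; apply: (smooth_metric g_smooth) => // r /g_riem[].
  - exact: nabla_LC.
  - exact: g_adapted.
  - by have [] := Dt_distr.
  - by have [] := D_distr.
  - exact: E_frame.
  - exact: F_frame.
have SP' t (ht : `|t| < eps) : splitting (g t) (nabla t) U D Dt (F t) (E t).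
  exact: splitting_swap (SP t ht).
move=> S inner Tr div div2 h ht T Tt H Ht A At Tsharp Ttsharp calTt calT calKt calK.
move=> nh nht nT nTt nH nHt is_Phi_h is_Phi_T is_Phi_ht is_Phi_Tt dt.
split; [|split; [|split]].
- move=> S_null t x lt_t Ux.
  have [d1 d2 d3 d4 d5] := variation_general g_smooth SP' S_null lt_t Ux.
  split.
  + by move: d1; rewrite div_op2_swap inner2_swap.
  + by move: d2; rewrite trace2_swap inner2_swap.
  + by move=> Phi; rewrite /is_Phi_h represents_swap /inner inner2_swap => /d3.
  + by move: d4; rewrite inner2_swap.
  + by move=> Phi; rewrite /is_Phi_T represents_swap /inner inner2_swap => /d5.
- move=> s s_smooth S_conf t x lt_t Ux.
  exact: (variation_conformal g_smooth SP' s_smooth S_conf lt_t Ux).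
- move=> S_null t x lt_t Ux; exact: (variation_general g_smooth SP S_null lt_t Ux).
- move=> s s_smooth S_conf t x lt_t Ux.
  exact: (variation_conformal g_smooth SP s_smooth S_conf lt_t Ux).
Qed.
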